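(* Let $f,g\in\mathcal{O}_K[x_1,\ldots,x_n]\setminus\pi\mathcal{O}_K[x_1,\ldots,x_n]$ ($n\ge 2$) be non-constant co-prime polynomials with $f(\boldsymbol 0)=g(\boldsymbol 0)=0$ and $\Gamma(f)\ne\Gamma(g)$, such that $\frac fg$ is non-degenerate over $\mathbb{F}_q$ with respect to $\Gamma(\frac fg)$, and let $\chi$ be a character of $\mathcal{O}_K^\times$. Let $(t_0,\ldots,t_0)$ be the unique intersection point of the diagonal $\{(t,\ldots,t):t\in\mathbb{R}\}$ with the boundary of $\Gamma(\frac fg)$. Then for every pole $s$ of $Z(s,\chi,\frac fg)$ with $\operatorname{Re}(s)>0$ one has $\operatorname{Re}(s)\ge1/t_0$ if $\chi\neq\chi_{triv}$; and $\operatorname{Re}(s)=1$ or $\operatorname{Re}(s)\ge1/t_0$ if $\chi=\chi_{triv}$.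
   Context: $K$ is a non-Archimedean local field of arbitrary characteristic, $\mathcal{O}_K$ its ring of integers, $\pi$ a fixed uniformizer, $\mathbb{F}_q$ the residue field, $\nu$ the valuation, $|z|_K=q^{-\nu(z)}$, $ac(z)=z\pi^{-\nu(z)}$ for $z\ne0$. $|d\boldsymbol x|_K$ is the Haar measure on $K^n$ with $\mathcal{O}_K^n$ of measure $1$. A bar denotes reduction modulo $\pi\mathcal{O}_K$. A character $\chi$ of $\mathcal{O}_K^\times$ is a continuous homomorphism to the complex unit circle, with $\chi(0)=0$ formally; $\chi_{triv}$ is the trivial character. Newton polyhedra. $\mathbb{R}_+=\{x\in\mathbb{R}:x\ge0\}$. For a non-constant polynomial $h=\sum c_{\boldsymbol m}\boldsymbol x^{\boldsymbol m}$ over $\mathcal{O}_K$ with $h(\boldsymbol 0)=0$, $\Gamma(h)$ is the convex hull of $\bigcup_{c_{\boldsymbol m}\ne0}(\boldsymbol m+\mathbb{R}_+^n)$. For $\boldsymbol k\in\mathbb{R}_+^n$: $d(\boldsymbol k,\Gamma)=\min_{\boldsymbol x\in\Gamma}\langle\boldsymbol k,\boldsymbol x\rangle$, $F(\boldsymbol k,\Gamma)=\{\boldsymbol x\in\Gamma:\langle\boldsymbol k,\boldsymbol x\rangle=d(\boldsymbol k,\Gamma)\}$, $h_{\boldsymbol k}(\boldsymbol x)=\sum_{\boldsymbol m\in F(\boldsymbol k,\Gamma(h))}c_{\boldsymbol m}\boldsymbol x^{\boldsymbol m}$. Put $\Gamma(\frac fg)=\Gamma(fg)$. Non-degeneracy.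 $\frac fg$ is non-degenerate over $\mathbb{F}_q$ with respect to $\Gamma(\frac fg)$ if, with $(h_1,h_2)=(f,g)$, for every $\boldsymbol k\in\mathbb{R}_+^n$, every non-empty $I\subseteq\{1,2\}$ and every $\overline{\boldsymbol z}\in(\mathbb{F}_q^\times)^n$ such that $\overline h_{i,\boldsymbol k}(\overline{\boldsymbol z})=0\Leftrightarrow i\in I$, the matrix $[\partial\overline h_{i,\boldsymbol k}/\partial x_j(\overline{\boldsymbol z})]_{i\in I,1\le j\le n}$ has rank $\mathrm{Card}(I)$. Zeta function. $Z(s,\chi,\frac fg):=Z(s,-s,\chi,\chi^{-1},f,g)$, where $Z(s_1,s_2,\chi_1,\chi_2,f,g)$ is the meromorphic continuation to $\mathbb{C}^2$ (as a rational function of $q^{-s_1},q^{-s_2}$) of $\int_{\mathcal{O}_K^n}\chi_1(ac(f(\boldsymbol x)))\chi_2(ac(g(\boldsymbol x)))|f(\boldsymbol x)|_K^{s_1}|g(\boldsymbol x)|_K^{s_2}|d\boldsymbol x|_K$, $\operatorname{Re}(s_i)>0$. *)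

(* Defs.v *)
From HB Require Import structures.
From mathcomp Require Import all_boot all_order all_algebra.
From mathcomp Require Import all_classical all_reals all_analysis.
From mathcomp Require Import complex.
(* The notations of mpoly and of all_analysis are incompatible. *)
From mathcomp Require Export -(notations) mpoly.

Set Implicit Arguments.
Unset Strict Implicit.
Unset Printing Implicit Defensive.

Import Order.TTheory GRing.Theory Num.Theory.
Import numFieldNormedType.Exports.

Local Open Scope classical_set_scope.
Local Open Scope ring_scope.

Notation "{ 'mpoly' T [ n ] }" := (mpoly n T)
  (at level 0, T, n at level 2, format "{ 'mpoly'  T [ n ] }") : type_scope.

(* Normalized discrete valuations. Mathematically nu 0 = +oo; here the value of
   [valuation] at 0 is unspecified, and every use below treats 0 apart. *)
HB.mixin Record hasDiscreteValuation K of GRing.Field K := {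
  valuation : K -> int;
  valuationM : forall x y : K, x != 0 -> y != 0 ->
    valuation (x * y) = valuation x + valuation y;
  valuationD : forall x y : K, x != 0 -> y != 0 -> x + y != 0 ->
    Num.min (valuation x) (valuation y) <= valuation (x + y);
  valuation_onto : exists x : K, x != 0 /\ valuation x = 1
}.

#[short(type="valuedFieldType")]
HB.structure Definition ValuedField :=
  { K of hasDiscreteValuation K & GRing.Field K }.

Section RingOfIntegers.
Variable K : valuedFieldType.

(* m <= nu x, with nu 0 = +oo *)
Definition val_ge (m : int) : {pred K} :=
  fun x => (x == 0) || (m <= valuation x).

Lemma valuation1 : valuation (1 : K) = 0.
Proof.
have := valuationM _ _ (oner_neq0 K) (oner_neq0 K).
by rewrite mulr1 => /(congr1 (fun z => z - valuation (1 : K))); rewrite addrK subrr.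
Qed.

Lemma valuationN1 : valuation (-1 : K) = 0.
Proof.
have N1 : (-1 : K) != 0 by rewrite oppr_eq0 oner_neq0.
have := valuationM _ _ N1 N1; rewrite mulrNN mulr1 valuation1 => /esym/eqP.
by rewrite -mulr2n mulrn_eq0 /= => /eqP.
Qed.

Lemma valuationN (x : K) : x != 0 -> valuation (- x) = valuation x.
Proof.
move=> x0; have N1 : (-1 : K) != 0 by rewrite oppr_eq0 oner_neq0.
by rewrite -mulN1r valuationM // valuationN1 add0r.
Qed.

Lemma val_ge0_subring : subring_closed (val_ge 0).
Proof.
split=> [|x y|x y]; rewrite !unfold_in.
- by rewrite valuation1 lexx orbT.
- have [->|x0] := eqVneq x 0; have [->|y0] //= := eqVneq y 0.
  + by rewrite subrr eqxx.
  + by rewrite sub0r valuationN // => _ ->; rewrite orbT.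
  + by rewrite subr0 => -> _; rewrite orbT.
  move=> vx vy; have [->//|xy0] /= := eqVneq (x - y) 0.
  have Ny0 : - y != 0 by rewrite oppr_eq0.
  apply: le_trans (valuationD _ _ x0 Ny0 xy0).
  by rewrite valuationN // le_min vx.
- have [->|x0] := eqVneq x 0; first by rewrite mul0r eqxx.
  have [->|y0] /= := eqVneq y 0; first by rewrite mulr0 eqxx.
  by move=> vx vy; rewrite valuationM // addr_ge0 // orbT.
Qed.

HB.instance Definition _ :=
  GRing.isSubringClosed.Build K (val_ge 0) val_ge0_subring.

Record integers := Integers { integers_val : K; _ : integers_val \in val_ge 0 }.

HB.instance Definition _ := [isSub for integers_val].
HB.instance Definition _ := [Choice of integers by <:].
HB.instance Definition _ := [SubChoice_isSubComNzRing of integers by <:].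

End RingOfIntegers.

(* Non-Archimedean local fields: complete for a discrete valuation, with finite
   residue field. The residue field is given up to isomorphism, as a finite
   field F with a surjective morphism from the ring of integers whose kernel is
   the maximal ideal. *)
HB.mixin Record isLocalField K of ValuedField K := {
  val_complete : forall u : nat -> K,
    (forall m : int, exists N, forall i j,
       (N <= i)%N -> (N <= j)%N -> u i - u j \in val_ge m) ->
    exists l : K, forall m : int, exists N, forall i,
       (N <= i)%N -> u i - l \in val_ge m;
  residue_field : finFieldType;
  residue : {rmorphism integers K -> residue_field};
  residue_surj : forall y, exists x, residue x = y;
  residue_ker : forall x : integers K,
    (residue x == 0) = (val x \in val_ge 1)
}.

#[short(type="localFieldType")]
HB.structure Definition LocalField :=
  { K of isLocalField K & ValuedField K }.

Section LocalFieldTheory.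
Variable K : localFieldType.

Definition is_uniformizer (p : integers K) : Prop :=
  val p != 0 /\ valuation (val p) = 1.

Definition integer_unit (u : K) : bool := (u != 0) && (valuation u == 0).

Definition residue_card : nat := #|@residue_field K|.

Definition abs_val (R : realType) (z : K) : R :=
  if z == 0 then 0 else (residue_card%:R : R) ^ (- valuation z).

Definition angular_component (p : integers K) (z : K) : K :=
  z * val p ^ (- valuation z).

(* [chi] is only meaningful on units and at 0. *)
Definition is_character (R : realType) (chi : K -> R[i]) : Prop :=
  [/\ forall u v, integer_unit u -> integer_unit v -> chi (u * v) = chi u * chi v,
      forall u, integer_unit u -> `|chi u| = 1,
      forall u, integer_unit u -> forall e : R, 0 < e -> exists m : int,
        forall v, integer_unit v -> v - u \in val_ge m ->
          `|chi v - chi u| < e%:C%C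
    & chi 0 = 0].

Definition is_trivial_character (R : realType) (chi : K -> R[i]) : Prop :=
  forall u, integer_unit u -> chi u = 1.

Definition local_space (n : nat) : Type := 'rV[K]_n.

HB.instance Definition _ n := Choice.on (local_space n).
HB.instance Definition _ n := isPointed.Build (local_space n) (0 : 'rV[K]_n).

Definition local_open (n : nat) : set (set (local_space n)) :=
  [set U | forall a : 'rV[K]_n, U a -> exists m : int,
     forall x : 'rV[K]_n, (forall i, x 0 i - a 0 i \in val_ge m) -> U x].

Definition borel_space (n : nat) := g_sigma_algebraType (@local_open n).

Definition integral_points (n : nat) : set (borel_space n) :=
  [set x : 'rV[K]_n | forall i, x 0 i \in val_ge 0].

Definition is_normalized_haar (R : realType) (n : nat)
    (mu : {measure set (borel_space n) -> \bar R}) : Prop :=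
  (forall (a : 'rV[K]_n) (A : set (borel_space n)), measurable A ->
     mu [set (x : 'rV[K]_n) + a | x in A] = mu A) /\
  mu (@integral_points n) = 1%E.

End LocalFieldTheory.

Section NewtonPolyhedra.
Variables (R : realType) (n : nat).

Definition orthant : set 'rV[R]_n := [set x | forall i, 0 <= x 0 i].

Definition exponent (m : multinom n) : 'rV[R]_n := \row_i (m i)%:R.

Definition newton_polyhedron (A : comNzRingType) (h : {mpoly A[n]}) :
    set 'rV[R]_n :=
  smallest (@convex_set R 'rV[R]_n)
    (\bigcup_(m in [set m | mcoeff m h != 0])
       [set exponent m + y | y in orthant]).

Definition dotp (k x : 'rV[R]_n) : R := \sum_i k 0 i * x 0 i.

(* d(k, G); for a Newton polyhedron and k in the orthant the infimum is a
   minimum. *)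
Definition support_value (k : 'rV[R]_n) (G : set 'rV[R]_n) : R :=
  inf [set dotp k x | x in G].

Definition face (k : 'rV[R]_n) (G : set 'rV[R]_n) : set 'rV[R]_n :=
  [set x | G x /\ dotp k x = support_value k G].

Definition face_poly (A : comNzRingType) (k : 'rV[R]_n) (h : {mpoly A[n]}) :
    {mpoly A[n]} :=
  \sum_(m <- msupp h | `[< face k (newton_polyhedron h) (exponent m) >])
    mcoeff m h *: mpolyX A m.

Definition newton_nondegenerate (A : comNzRingType) (F : fieldType)
    (red : {rmorphism A -> F}) (f g : {mpoly A[n]}) : Prop :=
  forall k : 'rV[R]_n, orthant k ->
  let hbar (i : 'I_2) : {mpoly F[n]} :=
    map_mpoly red (face_poly k (tnth [tuple f; g] i)) in
  forall I : {set 'I_2}, I != finset.set0 ->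
  forall z : 'I_n -> F, (forall j, z j != 0) ->
    (forall i, meval z (hbar i) = 0 <-> i \in I) ->
    \rank (\matrix_(i < #|I|, j < n) meval z (mderiv j (hbar (enum_val i))))
      = #|I|.

Definition diagonal_line : set 'rV[R]_n := range (fun t : R => const_mx t).

Definition boundary (G : set 'rV[R]_n) : set 'rV[R]_n := closure G `\` G°.

End NewtonPolyhedra.

Arguments diagonal_line : clear implicits.
Arguments newton_polyhedron R {n A} h.
Arguments newton_nondegenerate R {n A F} red f g.

Section Polynomials.
Variables (A : comNzRingType) (n : nat).

Definition nonconstant (f : {mpoly A[n]}) : Prop :=
  ~ exists c : A, f = mpolyC n c.

Definition coprime_mpoly (f g : {mpoly A[n]}) : Prop :=
  forall h f' g' : {mpoly A[n]}, f = h * f' -> g = h * g' ->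
    exists h' : {mpoly A[n]}, h * h' = 1.

End Polynomials.

Section Complex.
Variable R : realType.

Definition cexp (z : R[i]) : R[i] :=
  (expR (complex.Re z))%:C%C * (cos (complex.Im z) +i* sin (complex.Im z))%C.

(* a `^ s for a >= 0; only used at a = 0 when 0 < Re s *)
Definition cpow (a : R) (s : R[i]) : R[i] :=
  if a == 0 then 0 else cexp (s * (ln a)%:C%C).

Definition complex_integral d (T : measurableType d)
    (mu : {measure set T -> \bar R}) (D : set T) (h : T -> R[i]) : R[i] :=
  (Rintegral mu D (fun x => complex.Re (h x)) +i*
   Rintegral mu D (fun x => complex.Im (h x)))%C.

Definition is_pole (Z : R[i] -> R[i]) (s : R[i]) : Prop :=
  `|Z z| @[z --> (s : (R[i])^o)^'] --> +oo.

End Complex.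

Section Zeta.
Variables (R : realType) (K : localFieldType) (p : integers K) (n : nat).
Variable mu : {measure set (borel_space K n) -> \bar R}.

Definition eval_int (f : {mpoly (integers K)[n]}) (x : 'rV[K]_n) : K :=
  meval (fun i => x 0 i) (map_mpoly val f).

Definition zeta_integral (chi1 chi2 : K -> R[i]) (f g : {mpoly (integers K)[n]})
    (s1 s2 : R[i]) : R[i] :=
  complex_integral mu (@integral_points K n) (fun x =>
    chi1 (angular_component p (eval_int f x)) *
    chi2 (angular_component p (eval_int g x)) *
    cpow (abs_val R (eval_int f x)) s1 * cpow (abs_val R (eval_int g x)) s2).

(* P evaluated at (q^(-s1), q^(-s2)) *)
Definition eval_q (P : {mpoly R[i][2]}) (s1 s2 : R[i]) : R[i] :=
  meval (tnth [tuple cpow (residue_card K)%:R (- s1);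
                     cpow (residue_card K)%:R (- s2)]) P.

(* Z is s |-> Z2 (s, -s), where Z2 is the rational function P / Q of
   (q^(-s1), q^(-s2)) continuing [zeta_integral]. The representative P / Q is
   taken with Q not identically zero on s1 + s2 = 0, so that the restriction
   makes sense; it does not depend on the choice of such a representative.
   Nothing is said on the values of Z on the discrete set of zeros of Q, which
   do not matter for [is_pole]. *)
Definition is_zeta (chi : K -> R[i]) (f g : {mpoly (integers K)[n]})
    (Z : R[i] -> R[i]) : Prop :=
  exists P Q : {mpoly R[i][2]},
    [/\ forall s1 s2, 0 < complex.Re s1 -> 0 < complex.Re s2 ->
          eval_q Q s1 s2 != 0 ->
          zeta_integral chi (fun u => (chi u)^-1) f g s1 s2
            = eval_q P s1 s2 / eval_q Q s1 s2,
        exists s, eval_q Q s (- s) != 0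
      & forall s, eval_q Q s (- s) != 0 ->
          Z s = eval_q P s (- s) / eval_q Q s (- s)].

End Zeta.

(* Main.v *)
Require Import Defs.
From HB Require Import structures.
From mathcomp Require Import all_boot all_order all_algebra.
From mathcomp Require Import all_classical all_reals all_analysis.
From mathcomp Require Import complex.
From mathcomp Require Import measurable_realfun.
From mathcomp Require Import ring lra zify.

Set Implicit Arguments.
Unset Strict Implicit.
Unset Printing Implicit Defensive.

Import Order.TTheory GRing.Theory Num.Theory.
Import numFieldNormedType.Exports.
Import ComplexField.Normc.

Local Open Scope classical_set_scope.
Local Open Scope ring_scope.

(** The idea is to fix the first variable s and to continue the zeta integral
    in the second one only. Put x = q^(-s) and y = q^(-s2). Sorting the points by
    the valuation b of g,
        Z(s, s2) = sum_b C_b y^b,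
        C_b = integral over ord g = b of chi(ac f) chi^-1(ac g) |f|^s,
    for |y| < 1. There it is a rational function of y, say P / Q, so that P is the
    product of Q by this power series, coefficient by coefficient. Such an identity
    gives the value of P at any y at which the series converges absolutely: the
    continuation needs no analytic argument. The point of interest is y = 1 / x, of
    absolute value q^(Re s) > 1.

    For a nontrivial chi put W_b = C_b; for the trivial one, W_b = C_b - C_(b-1) / q,
    the coefficients of (1 - y / q) Z, whose first factor vanishes only for
    Re s = 1 on the line s2 = - s. Everything follows from a bound for
    sum_b |W_b| q^(b Re s) that is uniform for s in compact parts of
    0 < Re s < 1 / t0 ([coef_sum_le]).

    To get it, split the integral according to the valuations k of the coordinates,
    x = p^k u with u a vector of units. Let d and e be the minima of <k, .> on the
    Newton polyhedra of f and g. Then f(x) = p^d F(u) and g(x) = p^e G(u), and F, G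
    reduce to the face polynomials of f and g ([res_rescaled]), to which the
    nondegeneracy applies. Let c be such that chi is trivial on 1 + p^c.
    - If b < e the contribution to W_b vanishes.
    - If e + c < b it vanishes too ([layer_avg_cancel]). Near a common zero of the
      reductions of F and G the map (F, G) is a submersion modulo p, and near a zero
      of the reduction of G alone the map G is one; such a map carries the Haar
      measure to a Haar measure ([avg_submersion]). Where p^c divides G, its value
      is thus uniformly distributed in p^c O, independently of F, and either chi^-1
      averages to zero on the units, or the measure of ord G = j is divided by q as
      j grows by 1.
    - In the remaining c + 1 cases it is at most 2 q^(- |k| - d Re s), with |k| the
      sum of the k_i.
    As t0 (1, ..., 1) is in the closure of the polyhedron of f g, one has
    d + e <= t0 |k| ([diagonal_bound]), so the sum over b is at most a constant times
    the sum over k of q^(- (1 - t0 Re s) |k|), a product of convergent geometric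
    series.

    Integrals are computed as limits of averages over the residues modulo p^L
    ([riemann_sum]); translation invariance becomes the reindexing of finite sums. *)

(** * Averages over residue classes *)

Section Averages.
Variables (K : localFieldType) (p : integers K).
Hypothesis p_unif : is_uniformizer p.
Local Notation A := (integers K).
Local Notation F := (@residue_field K).
Local Notation res := (@residue K).

Lemma uniformizerX_neq0 m : val p ^+ m != 0.
Proof. by rewrite expf_neq0 //; case: p_unif. Qed.

Lemma valuationX m : valuation (val p ^+ m) = m%:Z.
Proof.
case: p_unif => p0 vp; elim: m => [|m IH]; first by rewrite expr0 valuation1.
rewrite exprS valuationM ?expf_neq0 // IH vp; lia.
Qed.

Lemma val_geP m (x : A) :
  reflect (exists t, x = p ^+ m * t) (val x \in val_ge m%:Z).
Proof.
rewrite unfold_in; apply: (iffP orP) => [|[t ->]].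
- have [x0 _|x0 []// mx] := eqVneq (val x) 0.
    by exists 0; rewrite mulr0; apply: val_inj; rewrite x0 rmorph0.
  have p0 := uniformizerX_neq0 m.
  have t0 : val x / val p ^+ m != 0 by rewrite mulf_neq0 ?invr_neq0.
  have vt : val x / val p ^+ m \in val_ge 0.
    apply/orP; right; rewrite -(lerD2r m%:Z) add0r -valuationX -valuationM //.
    by rewrite divfK // valuationX.
  exists (Integers vt); apply: val_inj.
  by rewrite rmorphM rmorphXn /= mulrC divfK.
- rewrite rmorphM rmorphXn /=.
  have [->|t0] := eqVneq (val t) 0; first by left; rewrite mulr0.
  right; rewrite valuationM ?uniformizerX_neq0 // valuationX.
  rewrite lerDl; case/orP: (valP t) => [t0'|//]; by rewrite t0' in t0.
Qed.

Lemma uniformizerX_lreg m (x : A) : p ^+ m * x = 0 -> x = 0.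
Proof.
move=> /(congr1 val); rewrite rmorphM rmorphXn rmorph0 /= => /eqP.
rewrite mulf_eq0 (negPf (uniformizerX_neq0 m)) /= => /eqP x0.
by apply: val_inj => /=; rewrite x0.
Qed.

Lemma uniformizerX_lregZ n m (x : 'rV[A]_n) : p ^+ m *: x = 0 -> x = 0.
Proof.
move=> px; apply/rowP => i; rewrite mxE; apply: (@uniformizerX_lreg m).
by have /rowP/(_ i) := px; rewrite !mxE.
Qed.

Lemma residue_eq0P (x : A) : res x = 0 <-> exists t, x = p * t.
Proof.
split=> [/eqP|[t ->]]; first by rewrite residue_ker => /(@val_geP 1).
by apply/eqP; rewrite residue_ker; apply/(@val_geP 1); exists t.
Qed.

Lemma residueP : res p = 0.
Proof. by apply/residue_eq0P; exists 1; rewrite mulr1. Qed.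

Definition residue_lift (y : F) : A := sval (cid (residue_surj y)).

Lemma residue_liftK y : res (residue_lift y) = y.
Proof. by rewrite /residue_lift; case: cid. Qed.

(** Representatives are built digit by digit, which makes the passage from level M
    to level M.+1 a product of finite types. *)
Fixpoint classes n M : finType :=
  if M is M'.+1 then (classes n M' * 'rV[F]_n)%type else unit.

Fixpoint rep n M : classes n M -> 'rV[A]_n :=
  if M is M'.+1 then fun v => rep v.1 + p ^+ M' *: map_mx residue_lift v.2
  else fun=> 0.

Lemma card_classes n M : #|classes n M| = (residue_card K ^ (n * M))%N.
Proof.
elim: M => [|M IH]; first by rewrite muln0 /= card_unit.
by rewrite /= card_prod IH card_mx mul1n mulnS expnD mulnC.
Qed.

Lemma rep_surj n M (x : 'rV[A]_n) : exists (v : classes n M) t, x = rep v + p ^+ M *: t.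
Proof.
elim: M => [|M [v [t ->]]]; first by exists tt, x; rewrite /= add0r scale1r.
have /fin_all_exists [u ut] :
    forall i, exists u, t 0 i - residue_lift (res (t 0 i)) = p * u.
  by move=> i; apply/residue_eq0P; rewrite rmorphB residue_liftK subrr.
exists (v, map_mx res t), (\row_i u i) => /=.
rewrite -addrA; congr (_ + _); rewrite exprSr -scalerA -scalerDr.
by congr (_ *: _); apply/rowP => i; rewrite !mxE -ut; ring.
Qed.

Lemma rep_inj n M (v v' : classes n M) t :
  rep v = rep v' + p ^+ M *: t -> v = v'.
Proof.
elim: M v v' t => [[] []//|M IH] [v y] [v' y'] t /= e.
have vv' : v = v'.
  apply: (IH _ _ (map_mx residue_lift y' - map_mx residue_lift y + p *: t)).
  move/(canRL (addrK _)): e => ->.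
  by rewrite exprSr !scalerDr scalerN scalerA -!addrA; congr (_ + (_ + _)); rewrite addrC.
rewrite -{v'}vv' in e *; congr (_, _).
move: e; rewrite -addrA => /addrI.
move/eqP; rewrite -subr_eq0 exprSr -scalerA -scalerDr -scalerBr => /eqP.
move/uniformizerX_lregZ/rowP => e.
apply/rowP => i; have /(congr1 res) := e i.
rewrite !mxE rmorphB rmorphD rmorphM residueP mul0r addr0 !residue_liftK rmorph0.
by move=> /eqP; rewrite subr_eq0 => /eqP.
Qed.

Variable C : numFieldType.

(** Functions on (O / p^M)^n, seen as functions on O^n. *)
Definition invariant_mod n M (Th : 'rV[A]_n -> C) :=
  forall x t, Th (x + p ^+ M *: t) = Th x.

(** The normalized Haar integral over O^n of a function that is invariant modulo
    p ^ M; its value on other functions depends on the representatives. *)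
Definition avg n M (Th : 'rV[A]_n -> C) : C :=
  (#|classes n M|%:R)^-1 * \sum_(v : classes n M) Th (rep v).

Lemma card_classes_gt0 n M : 0 < #|classes n M|%:R :> C.
Proof.
rewrite ltr0n card_classes expn_gt0 /residue_card; apply/orP; left.
by apply/card_gt0P; exists 0.
Qed.

Lemma avg_ext n M (Th Th' : 'rV[A]_n -> C) :
  Th =1 Th' -> avg M Th = avg M Th'.
Proof. by move=> e; congr (_ * _); apply: eq_bigr => v _. Qed.

Lemma avgD n M (Th Th' : 'rV[A]_n -> C) :
  avg M (fun x => Th x + Th' x) = avg M Th + avg M Th'.
Proof. by rewrite /avg big_split /= mulrDr. Qed.

Lemma avgZ n M c (Th : 'rV[A]_n -> C) :
  avg M (fun x => c * Th x) = c * avg M Th.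
Proof. by rewrite /avg -mulr_sumr mulrCA. Qed.

Lemma avgB n M (Th Th' : 'rV[A]_n -> C) :
  avg M (fun x => Th x - Th' x) = avg M Th - avg M Th'.
Proof. by rewrite /avg sumrB mulrBr. Qed.

Lemma avg_sum n M I (r : seq I) (P : pred I) (Th : I -> 'rV[A]_n -> C) :
  avg M (fun x => \sum_(i <- r | P i) Th i x) =
  \sum_(i <- r | P i) avg M (Th i).
Proof. by rewrite /avg exchange_big /= mulr_sumr. Qed.

Lemma avg_cst n M c : avg M (fun _ : 'rV[A]_n => c) = c.
Proof.
by rewrite /avg sumr_const -[c *+ _]mulr_natl mulKf ?gt_eqF ?card_classes_gt0.
Qed.

Lemma avg_le n M (Th th : 'rV[A]_n -> C) :
  (forall x, Th x <= th x) -> avg M Th <= avg M th.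
Proof.
move=> le; rewrite /avg ler_pM2l ?invr_gt0 ?card_classes_gt0 //.
exact: ler_sum.
Qed.

Lemma avg_exchange m n L M (Th : 'rV[A]_m -> 'rV[A]_n -> C) :
  avg L (fun x => avg M (Th x)) = avg M (fun y => avg L (Th^~ y)).
Proof.
rewrite /avg; under eq_bigr do rewrite mulr_sumr.
under [in RHS]eq_bigr do rewrite mulr_sumr.
rewrite exchange_big /= !mulr_sumr; apply: eq_bigr => v _.
by rewrite !mulr_sumr; apply: eq_bigr => w _; rewrite mulrCA.
Qed.

(** A self-map of O^n that is injective modulo p ^ M permutes the residue classes,
    as there are finitely many of them. *)
Lemma avg_reindex n M (Th : 'rV[A]_n -> C) (T : 'rV[A]_n -> 'rV[A]_n) :
  invariant_mod M Th ->
  (forall x y t, T x = T y + p ^+ M *: t -> exists u, x = y + p ^+ M *: u) ->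
  avg M (fun x => Th (T x)) = avg M Th.
Proof.
move=> inv Tinj; rewrite /avg; congr (_ * _).
have /fin_all_exists [h hP] :
    forall v : classes n M, exists w : classes n M, exists t, T (rep v) = rep w + p ^+ M *: t.
  by move=> v; exact: rep_surj.
have h_inj : injective h.
  move=> v w e; have [t et] := hP v; have [s es] := hP w.
  have [|u] := Tinj (rep v) (rep w) (t - s); last exact: rep_inj.
  by rewrite et es e scalerBr addrACA addrN addr0.
rewrite [RHS](reindex h) /=; last first.
  by exists (invF h_inj) => v _; [rewrite invF_f|rewrite f_invF].
by apply: eq_bigr => v _; have [t ->] := hP v; rewrite inv.
Qed.

Lemma avg_shift n M (Th : 'rV[A]_n -> C) a :
  invariant_mod M Th -> avg M (fun x => Th (x + a)) = avg M Th.
Proof.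
move=> inv; apply: (@avg_reindex _ _ _ (fun x => x + a)) => // x y t.
by rewrite addrAC => /addIr ->; exists t.
Qed.

Lemma avg_levelS n M (Th : 'rV[A]_n -> C) :
  invariant_mod M Th -> avg M.+1 Th = avg M Th.
Proof.
move=> inv; rewrite /avg /=.
rewrite -(pair_big xpredT xpredT (fun (v : classes n M) w =>
  Th (rep v + p ^+ M *: map_mx residue_lift w))) /=.
under eq_bigr do under eq_bigr do rewrite inv.
under eq_bigr do rewrite sumr_const -[_ *+ _]mulr_natl.
rewrite -mulr_sumr card_prod natrM invfM -mulrA; congr (_ * _).
rewrite mulKf //; have := card_classes_gt0 n 1.
by rewrite /= card_prod card_unit mul1n => /gt_eqF ->.
Qed.

End Averages.
Arguments residue_lift {K} y.

(** * Equidistribution *)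

Section Equidistribution.
Variables (K : localFieldType) (p : integers K).
Hypothesis p_unif : is_uniformizer p.
Local Notation A := (integers K).
Local Notation F := (@residue_field K).
Local Notation res := (@residue K).
Variable C : numFieldType.

Lemma avg_level0 n (Th : 'rV[A]_n -> C) : avg p 0 Th = Th 0.
Proof. by rewrite /avg /= (big_pred1 tt) ?card_unit ?invr1 ?mul1r //; case. Qed.

(** A map H that is a submersion modulo p at every scale sends the uniform measure
    to the uniform measure on H 0 + p^c O^r. Going from level M to M.+1, translating
    t by p^M (D w) moves H t by p^(c + M) w up to higher order, so that averaging
    over w replaces the function Th of H t by its average Th' over a class modulo
    p^(c + M): the level drops by one. *)
Lemma avg_submersion n r c M (H : 'rV[A]_n -> 'rV[A]_r)
    (D : 'rV[A]_r -> 'rV[A]_n) (Th : 'rV[A]_r -> C) :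
  (forall N t v, exists u, H (t + p ^+ N *: v) = H t + p ^+ (c + N) *: u) ->
  (forall N t w, exists u,
     H (t + p ^+ N *: D w) = H t + p ^+ (c + N) *: w + p ^+ (c + N).+1 *: u) ->
  invariant_mod p (c + M) Th ->
  avg p M (fun t => Th (H t)) = avg p M (fun y => Th (H 0 + p ^+ c *: y)).
Proof.
move=> Hc HD; elim: M Th => [|M IH] Th inv.
  by rewrite !avg_level0 scaler0 addr0.
pose Th' y := avg p 1 (fun w : 'rV[A]_r => Th (y + p ^+ (c + M) *: w)).
have inv1 y : invariant_mod p 1 (fun w : 'rV[A]_r => Th (y + p ^+ (c + M) *: w)).
  by move=> x t; rewrite scalerDr scalerA -exprD addrA -addnA addn1 inv.
have inv' : invariant_mod p (c + M) Th'.
  move=> y t; rewrite /Th' -(avg_shift p_unif t (inv1 y)); apply: avg_ext => w.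
  by rewrite scalerDr [p ^+ _ *: w + _]addrC addrA.
have invH : invariant_mod p M.+1 (fun t => Th (H t)).
  by move=> x t; have [u ->] := Hc M.+1 x t; rewrite inv.
transitivity (avg p M.+1 (fun t => Th' (H t))).
  rewrite -[LHS](avg_cst p r 1) /Th' [RHS]avg_exchange; apply: avg_ext => w.
  rewrite -(avg_shift p_unif (p ^+ M *: D w) invH); apply: avg_ext => t.
  by have [u ->] := HD M t w; rewrite -addnS inv.
have invH' : invariant_mod p M (fun t => Th' (H t)).
  by move=> x t; have [u ->] := Hc M x t; rewrite inv'.
rewrite avg_levelS // (IH _ inv') -[LHS]avg_levelS; last first.
  by move=> x t; rewrite scalerDr scalerA -exprD addrA inv'.
rewrite -[RHS](avg_cst p r 1) /Th' avg_exchange; apply: avg_ext => w.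
rewrite -[RHS](avg_shift p_unif (p ^+ M *: w)); last first.
  by move=> x t; rewrite scalerDr scalerA -exprD addrA inv.
by apply: avg_ext => y; rewrite scalerDr scalerA -exprD addrA.
Qed.

(** The total average is unchanged when y is translated along the i-th axis, hence
    also when one first averages over these translations. *)
Lemma avg_coord0 r (i : 'I_r) M (Th : 'rV[A]_r -> C) :
  invariant_mod p M Th ->
  (forall y, avg p M (fun t : 'rV[A]_1 => Th (y + t 0 0 *: delta_mx 0 i)) = 0) ->
  avg p M Th = 0.
Proof.
move=> inv H; rewrite -(avg_cst p 1 M (avg p M Th)).
under avg_ext => t do rewrite -(avg_shift p_unif (t 0 0 *: delta_mx 0 i) inv).
rewrite avg_exchange -[RHS](avg_cst p r M 0).
by apply: avg_ext => y; rewrite H.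
Qed.

Definition dvd_unif m (a : A) : bool := val a \in val_ge m%:Z.

Lemma dvd_unifP m (a : A) : reflect (exists t, a = p ^+ m * t) (dvd_unif m a).
Proof. exact: val_geP. Qed.

Lemma dvd_unifM m j a : dvd_unif (m + j) (p ^+ m * a) = dvd_unif j a.
Proof.
apply/dvd_unifP/dvd_unifP => -[t e]; exists t; last by rewrite e exprD mulrA.
apply/eqP; rewrite -subr_eq0; apply/eqP; apply: (@uniformizerX_lreg _ _ p_unif m).
by rewrite mulrBr e exprD mulrA subrr.
Qed.

Lemma dvd_unifS m a : dvd_unif m.+1 (p ^+ m * a) = (res a == 0).
Proof.
rewrite -addn1 dvd_unifM; apply/dvd_unifP/eqP => [[t]|/(residue_eq0P p_unif)];
by [move=> ?; apply/(residue_eq0P p_unif); exists t|].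
Qed.

Lemma dvd_unif0 a : dvd_unif 0 a.
Proof. exact: valP. Qed.

Lemma dvd_unif_le m m' a : (m <= m')%N -> dvd_unif m' a -> dvd_unif m a.
Proof.
move=> /subnKC <- /dvd_unifP[t ->]; apply/dvd_unifP.
by exists (p ^+ (m' - m) * t); rewrite mulrA exprD.
Qed.

Lemma dvd_unif_mul m a b : dvd_unif m a -> dvd_unif m (a * b).
Proof. by move=> /dvd_unifP[t ->]; apply/dvd_unifP; exists (t * b); rewrite mulrA. Qed.

Lemma dvd_unif_pmul m j a : (m <= j)%N -> dvd_unif m (p ^+ j * a).
Proof. by move=> mj; apply: (dvd_unif_le mj); apply/dvd_unifP; exists a. Qed.

Lemma dvd_unifD m a b : dvd_unif m a -> dvd_unif m b -> dvd_unif m (a + b).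
Proof.
move=> /dvd_unifP[t ->] /dvd_unifP[u ->].
by apply/dvd_unifP; exists (t + u); rewrite mulrDr.
Qed.

Lemma dvd_unif_addr m a b : dvd_unif m b -> dvd_unif m (a + b) = dvd_unif m a.
Proof.
move=> mb; apply/idP/idP => [h|h]; last exact: dvd_unifD.
have -> : a = a + b + b * (-1) by ring.
by apply: dvd_unifD => //; exact: dvd_unif_mul.
Qed.

(** Decreasing one k i by 1 cuts the polydisc into q
    translates of the smaller one. *)
Lemma avg_box n M (k : 'I_n -> nat) : (forall i, k i <= M)%N ->
  avg p M (fun x : 'rV[A]_n => ([forall i, dvd_unif (k i) (x 0 i)] : nat)%:R : C)
  = (residue_card K)%:R ^- (\sum_i k i).
Proof.
have [s] := ubnP (\sum_i k i); elim: s k => // s IH k ks kM.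
have [/forallP k0|] := boolP [forall i, k i == 0%N].
  rewrite big1 => [|i _]; last exact/eqP.
  rewrite expr0 invr1 -[RHS](avg_cst p n M); apply: avg_ext => x.
  by case: forallP => // -[] i; rewrite (eqP (k0 i)) dvd_unif0.
rewrite negb_forall => /existsP[i0 ki0].
pose k' i := if i == i0 then (k i0).-1 else k i.
have sk : (\sum_i k i = (\sum_i k' i).+1)%N.
  rewrite (bigD1 i0) //= [in RHS](bigD1 i0) //= {1}/k' eqxx -addSn prednK ?lt0n //.
  by congr (_ + _)%N; apply: eq_bigr => i /negPf ii0; rewrite /k' ii0.
have k'M i : (k' i <= M)%N.
  by rewrite /k'; case: eqP => // _; apply: leq_trans (kM i0); exact: leq_pred.
rewrite sk exprS invfM -IH //; last by rewrite -ltnS -sk.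
set b := avg _ _ _; set b' := avg _ _ _.
have q0 : (residue_card K)%:R != 0 :> C.
  by have /gt_eqF := card_classes_gt0 K C 1 1; rewrite card_classes muln1 expn1 => ->.
apply: (mulfI q0); rewrite mulVKf // mulr_natl -sumr_const.
pose sh (w : F) : 'rV[A]_n := (p ^+ k' i0 * residue_lift w) *: delta_mx 0 i0.
have inv : invariant_mod p M
    (fun x : 'rV[A]_n => ([forall i, dvd_unif (k i) (x 0 i)] : nat)%:R : C).
  move=> x t; congr (nat_of_bool _)%:R; apply: eq_forallb => i.
  by rewrite !mxE dvd_unif_addr //; apply: dvd_unif_pmul.
under eq_bigr => w _ do rewrite /b -(avg_shift p_unif (sh w) inv).
rewrite -avg_sum; apply: avg_ext => x; rewrite -natr_sum; congr _%:R.
have shE w i : (x + sh w) 0 i =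
    if i == i0 then x 0 i0 + p ^+ k' i0 * residue_lift w else x 0 i.
  by rewrite !mxE eqxx /=; case: eqP => [->|_]; rewrite ?mulr1 // mulr0 addr0.
have [/forallP kx|kx] := boolP [forall i, dvd_unif (k' i) (x 0 i)].
  (* the only digit that makes x 0 i0 divisible once more is - res y *)
  have /dvd_unifP[y xy] := kx i0.
  rewrite (bigD1 (- res y)) //= big1 => [|w wy].
    rewrite addn0; apply/eqP; rewrite eqb1; apply/forallP => i; rewrite shE.
    case: eqP => [->|/eqP/negPf ii0]; last by have := kx i; rewrite /k' ii0.
    rewrite xy -mulrDr -(prednK (_ : 0 < k i0)%N) ?lt0n //.
    by rewrite {1}/k' eqxx dvd_unifS rmorphD residue_liftK subrr.
  apply/eqP; rewrite eqb0 negb_forall; apply/existsP; exists i0; rewrite shE eqxx.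
  rewrite xy -mulrDr -(prednK (_ : 0 < k i0)%N) ?lt0n //.
  by rewrite {1}/k' eqxx dvd_unifS rmorphD residue_liftK addrC addr_eq0.
rewrite big1 // => w _; apply/eqP; rewrite eqb0; apply: contra kx.
move=> /forallP h; apply/forallP => i; have := h i; rewrite shE /k'.
case: eqP => [-> kk|//].
have : dvd_unif (k i0).-1 (x 0 i0 + p ^+ k' i0 * residue_lift w).
  by apply: dvd_unif_le kk; exact: leq_pred.
by rewrite dvd_unif_addr //; apply: dvd_unif_pmul; rewrite /k' eqxx.
Qed.

Lemma avg_box1 n M (i : 'I_n) k : (k <= M)%N ->
  avg p M (fun x : 'rV[A]_n => (dvd_unif k (x 0 i) : nat)%:R : C)
  = (residue_card K)%:R ^- k.
Proof.
move=> kM; have {2}-> : k = (\sum_j (if j == i then k else 0))%N.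
  by rewrite -big_mkcond big_pred1_eq.
rewrite -(@avg_box n M) => [|j]; last by case: eqP.
apply: avg_ext => x; congr (nat_of_bool _)%:R.
apply/idP/forallP => [h j|/(_ i)]; last by rewrite eqxx.
by case: eqP => [->//|_]; exact: dvd_unif0.
Qed.

End Equidistribution.

(** * Complex powers *)

Section ComplexPowers.
Variable R : realType.
Implicit Types z : R[i].

Lemma norm_normc z : `|z| = (normc z)%:C%C. Proof. by []. Qed.

Lemma normc_ge0 z : 0 <= normc z.
Proof. by rewrite -lecR -norm_normc normr_ge0. Qed.

Lemma normc_real (a : R) : normc a%:C%C = `|a|.
Proof. by rewrite /= expr0n /= addr0 sqrtr_sqr. Qed.

Lemma normcX z n : normc (z ^+ n) = normc z ^+ n.
Proof. by elim: n => [|n IH]; rewrite ?expr0 ?normc1 // !exprS normcM IH. Qed.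

Lemma normc_sum I (r : seq I) (P : pred I) (F : I -> R[i]) :
  normc (\sum_(i <- r | P i) F i) <= \sum_(i <- r | P i) normc (F i).
Proof.
elim/big_rec2: _ => [|i x y _ le]; first by rewrite normc0.
by apply: le_trans (le_normcD _ _) _; rewrite lerD2l.
Qed.

Lemma le_normcB (z w : R[i]) : normc (z - w) <= normc z + normc w.
Proof. by rewrite -(normcN w); exact: le_normcD. Qed.

Lemma cexpD (a b : R[i]) : cexp (a + b) = cexp a * cexp b.
Proof.
case: a b => [a1 a2] [b1 b2]; rewrite /cexp /= expRD cosD sinD.
apply/eqP; rewrite eq_complex /=; apply/andP; split; apply/eqP; ring.
Qed.

Lemma cexp0 : cexp 0 = 1 :> R[i].
Proof. by rewrite /cexp /= expR0 cos0 sin0 mul1r. Qed.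

Lemma normc_cexp z : normc (cexp z) = expR (complex.Re z).
Proof.
rewrite /cexp normcM normc_real ger0_norm ?expR_ge0 //.
by rewrite /normc cos2Dsin2 sqrtr1 mulr1.
Qed.

Lemma cexp_natM n z : cexp (n%:R * z) = cexp z ^+ n.
Proof.
elim: n => [|n IH]; first by rewrite mul0r cexp0.
by rewrite exprS -IH -cexpD -natr1 mulrDl mul1r addrC.
Qed.

Lemma cpow_gt0 (a : R) (s : R[i]) : 0 < a -> cpow a s = cexp (s * (ln a)%:C%C).
Proof. by rewrite /cpow => /gt_eqF ->. Qed.

Lemma cpow_neq0 (a : R) (s : R[i]) : 0 < a -> cpow a s != 0.
Proof.
move=> a0; rewrite cpow_gt0 //; apply/eqP => /(congr1 (@normc R)).
by rewrite normc_cexp normc0 => /eqP; rewrite gt_eqF ?expR_gt0.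
Qed.

Lemma cpowN (a : R) (s : R[i]) : 0 < a -> cpow a (- s) = (cpow a s)^-1.
Proof.
move=> a0; apply: (mulfI (cpow_neq0 s a0)); rewrite mulfV ?cpow_neq0 //.
by rewrite !cpow_gt0 // -cexpD mulNr addrN cexp0.
Qed.

Lemma normc_cpow (a : R) (s : R[i]) : 0 < a -> normc (cpow a s) = a `^ (complex.Re s).
Proof.
move=> a0; rewrite cpow_gt0 // normc_cexp /powR gt_eqF //; congr expR.
by case: s => u v; rewrite /= mulr0 subr0.
Qed.

Lemma cpow_exprz (a : R) (s : R[i]) n : 0 < a ->
  cpow (a ^ (- n%:Z)) s = cpow a (- s) ^+ n.
Proof.
move=> a0; rewrite !cpow_gt0 ?exprz_gt0 // -cexp_natM; congr cexp.
rewrite -invr_expz lnV ?posrE ?exprz_gt0 // lnXn //.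
rewrite rmorphN raddfMn -mulr_natl. ring.
Qed.

Lemma cpow_real (a t : R) : 0 < a -> cpow a t%:C%C = (a `^ t)%:C%C.
Proof.
move=> a0; rewrite cpow_gt0 // /powR gt_eqF // -rmorphM /cexp /=.
by rewrite cos0 sin0 mulr1.
Qed.

(** The unit circle has no small subgroups: as long as z^(2^k) stays close to 1,
    |z^(2^k) + 1| >= 3/2, so that the distance from z^(2^k) to 1 grows
    geometrically. This is what gives a conductor to a continuous character. *)
Lemma no_small_subgroup z : (forall k, normc (z ^+ k - 1) <= 2^-1) -> z = 1.
Proof.
move=> h; have key k : (3 / 2) ^+ k * normc (z - 1) <= normc (z ^+ (2 ^ k) - 1).
  elim: k => [|k IH]; first by rewrite expr0 mul1r expn0 expr1.
  rewrite expnSr exprM [X in _ <= normc X](_ : _ =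
    (z ^+ (2 ^ k) - 1) * (z ^+ (2 ^ k) + 1)); last by ring.
  rewrite normcM.
  rewrite exprSr mulrAC ler_pM ?mulr_ge0 ?exprn_ge0 ?normc_ge0 //.
  have := le_normcB (z ^+ (2 ^ k) + 1) (z ^+ (2 ^ k) - 1).
  rewrite (_ : _ - _ = 2%:R%:C%C); last by rewrite rmorph_nat; ring.
  rewrite normc_real ger0_norm //; have := h (2 ^ k)%N; lra.
apply/eqP; rewrite -subr_eq0; apply/eqP/eq0_normc; apply/eqP.
rewrite eq_le normc_ge0 andbT leNgt; apply/negP => z0.
(* Bernoulli's inequality makes the growth explicit. *)
have bern k : 1 + k%:R / 2 <= (3 / 2) ^+ k :> R.
  elim: k => [|k IH]; first by rewrite expr0 mul0r addr0.
  have := mulr_ge0 (ler0n R k) (ler0n R 1); rewrite exprS -natr1; nra.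
have [k kb] : exists k, 1 / normc (z - 1) < k%:R.
  by exists (Num.bound (1 / normc (z - 1))); apply: archi_boundP; rewrite divr_ge0 ?normc_ge0.
have := le_trans (key k) (h _); move: kb; rewrite ltr_pdivrMr // => kb.
have := bern k; nra.
Qed.

End ComplexPowers.

(** * Characters of the units and the functions chi(ac a)|a|^s *)

Section Characters.
Variables (R : realType) (K : localFieldType) (p : integers K).
Hypothesis p_unif : is_uniformizer p.
Local Notation A := (integers K).
Local Notation res := (@residue K).
Local Notation q := ((residue_card K)%:R : R).
Implicit Types (a u t : A) (chi : K -> R[i]) (s : R[i]).

Lemma residue_card_gt1 : 1 < q.
Proof. by rewrite ltr1n; exact: card_finNzRing_gt1. Qed.

Lemma residue_card_gt0 : 0 < q.
Proof. exact: lt_trans ltr01 residue_card_gt1. Qed.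

Lemma residue_unit u : res u != 0 -> val u != 0 /\ valuation (val u) = 0.
Proof.
rewrite residue_ker unfold_in /= negb_or -ltNge => /andP[u0 vu]; split => //.
have := valP u; rewrite unfold_in (negPf u0) /= => vu'.
by apply/eqP; rewrite eq_le vu' andbT -ltzD1 add0r.
Qed.

Lemma integer_unitE u : integer_unit (val u) = (res u != 0).
Proof.
apply/idP/idP => [/andP[u0 /eqP vu]|/residue_unit[u0 vu]].
  by rewrite residue_ker unfold_in (negPf u0) vu.
by rewrite /integer_unit u0 vu eqxx.
Qed.

Lemma integer_unitP (z : K) : integer_unit z -> exists2 u, z = val u & res u != 0.
Proof.
move=> zu; have zi : z \in val_ge 0.
  by move: zu => /andP[_ /eqP vz]; rewrite unfold_in vz lexx orbT.
by exists (Integers zi) => //; rewrite -integer_unitE.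
Qed.

(** ord m a means that the valuation of a is exactly m; 0 has no ord. *)
Definition ord m a := dvd_unif m a && ~~ dvd_unif m.+1 a.

Lemma ordP m a : reflect (exists2 u, a = p ^+ m * u & res u != 0) (ord m a).
Proof.
apply: (iffP andP) => [[/(dvd_unifP p_unif)[u ->]]|[u -> u0]].
  by rewrite dvd_unifS // => u0; exists u.
by rewrite dvd_unifS // dvd_unif_pmul.
Qed.

Lemma valuation_ord m u : res u != 0 ->
  val (p ^+ m * u) != 0 /\ valuation (val (p ^+ m * u)) = m%:Z.
Proof.
move=> /residue_unit[u0 vu]; rewrite rmorphM rmorphXn /=.
have p0 := uniformizerX_neq0 p_unif m.
split; first by rewrite mulf_neq0.
by rewrite valuationM // valuationX // vu addr0.
Qed.

Lemma angular_component_ord m u : res u != 0 ->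
  angular_component p (val (p ^+ m * u)) = val u.
Proof.
move=> u0; rewrite /angular_component; have [_ ->] := valuation_ord m u0.
rewrite rmorphM rmorphXn /= -invr_expz -exprnP mulrAC mulfV ?mul1r //.
exact: uniformizerX_neq0.
Qed.

Lemma abs_val_ord m u : res u != 0 -> abs_val R (val (p ^+ m * u)) = q ^ (- m%:Z).
Proof.
by move=> u0; rewrite /abs_val; have [/negPf -> ->] := valuation_ord m u0.
Qed.

Lemma ord_total a : a = 0 \/ exists m, ord m a.
Proof.
have [a0|a0] := eqVneq (val a) 0; [left|right].
  by apply: val_inj => /=; rewrite a0.
have va := valP a; exists (absz (valuation (val a))).
rewrite /ord /dvd_unif !unfold_in (negPf a0) /=.
move: va; rewrite unfold_in (negPf a0) /= => va; lia.
Qed.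

Lemma ord_inj m m' a : ord m a -> ord m' a -> m = m'.
Proof.
by move=> /ordP[u -> u0] /ordP[v e v0]; have [_] := valuation_ord m u0;
  rewrite e; have [_ ->] := valuation_ord m' v0 => -[].
Qed.

Lemma ord_ge m a : dvd_unif m a -> a = 0 \/ exists2 m', ord m' a & (m <= m')%N.
Proof.
move=> ma; have [->|[m' om]] := ord_total a; [by left|right].
exists m' => //; rewrite leqNgt; apply/negP => mm'.
by case/andP: om => _ /negP nm; case: nm; exact: (dvd_unif_le p_unif mm' ma).
Qed.

Lemma ord_lt m a : ~~ dvd_unif m a -> exists2 m', ord m' a & (m' < m)%N.
Proof.
have [->|[m' om]] := ord_total a.
  by rewrite (_ : dvd_unif m 0) //; apply/(dvd_unifP p_unif); exists 0; rewrite mulr0.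
move=> ma; exists m' => //; rewrite ltnNge; apply: contra ma => mm'.
by apply: (dvd_unif_le p_unif mm'); case/andP: om.
Qed.

(** A unitary character of the units that factors through the units modulo
    p ^ c, extended by zero. *)
Definition character_mod c chi := [/\
  forall u v, res u != 0 -> res v != 0 -> chi (val (u * v)) = chi (val u) * chi (val v),
  forall u, res u != 0 -> normc (chi (val u)) = 1,
  forall u t, res u != 0 -> chi (val (u + p ^+ c * t)) = chi (val u),
  chi 0 = 0 & (0 < c)%N].

Lemma residueD_pX c u t : (0 < c)%N -> res (u + p ^+ c * t) = res u.
Proof.
by case: c => // c _; rewrite rmorphD exprS -mulrA rmorphM (residueP p_unif) mul0r addr0.
Qed.

Lemma character_mod_trivial chi : is_character chi -> is_trivial_character chi ->
  character_mod 1 chi.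
Proof.
move=> [_ _ _ chi0] triv; split=> // [u v u0 v0|u u0|u t u0].
- by rewrite !triv ?mulr1 ?integer_unitE // rmorphM mulf_neq0 //.
- by rewrite triv ?integer_unitE // normc1.
- by rewrite !triv ?integer_unitE ?residueD_pX.
Qed.

Lemma residue_inv u : res u != 0 -> exists2 v, u * v = 1 & res v != 0.
Proof.
move=> u0; have [vu0 vu] := residue_unit u0.
have iu : integer_unit (val u)^-1.
  rewrite /integer_unit invr_eq0 vu0 /=.
  have := valuationM _ _ vu0 (invr_neq0 vu0).
  by rewrite mulfV // valuation1 vu add0r => <-.
have [v e v0] := integer_unitP iu; exists v => //.
by apply: val_inj; rewrite rmorphM /= -[integers_val v]e mulfV.
Qed.

Lemma character_mod_exists chi : is_character chi -> exists c, character_mod c chi.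
Proof.
move=> [chiM chiN chiC chi0].
have i1 : integer_unit (val (1 : A)) by rewrite integer_unitE rmorph1 oner_neq0.
have chi1 : chi (val (1 : A)) = 1.
  have n0 : chi (val (1 : A)) != 0.
    by apply: contra_eqN (chiN _ i1) => /eqP ->; rewrite normr0 eq_sym oner_neq0.
  by apply: (mulfI n0); rewrite -chiM // -rmorphM !mulr1.
have h0 : 0 < 2^-1 :> R by rewrite invr_gt0.
have [m hm] := chiC _ i1 _ h0.
have one_mod c u t : (0 < c)%N -> (m <= c%:Z) -> u = 1 + p ^+ c * t -> chi (val u) = 1.
  move=> c0 mc ut; apply: no_small_subgroup => k.
  have ru j : res (u ^+ j) != 0 by rewrite rmorphXn ut residueD_pX // rmorph1 expr1n oner_neq0.
  have -> : chi (val u) ^+ k = chi (val (u ^+ k)).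
    elim: k => [|k IH]; first by rewrite !expr0 chi1.
    by rewrite !exprS IH rmorphM chiM ?integer_unitE // -(expr1 u).
  rewrite -lecR -norm_normc -chi1; apply: ltW; apply: hm; first by rewrite integer_unitE.
  have [t' ->] : exists t', u ^+ k = 1 + p ^+ c * t'.
    elim: k => [|k [t' IH]]; first by exists 0; rewrite mulr0 addr0.
    by exists (t + t' * u); rewrite exprSr IH ut; ring.
  have : dvd_unif c (p ^+ c * t') by rewrite dvd_unif_pmul.
  rewrite -rmorphB addrAC subrr add0r /dvd_unif !unfold_in => /orP[->//|h].
  by rewrite (le_trans mc h) orbT.
exists (absz m).+1; split=> // [u v u0 v0|u u0|u t u0].
- by rewrite -chiM ?integer_unitE.
- by apply: complexI; rewrite -norm_normc chiN ?integer_unitE.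
have [v uv v0] := residue_inv u0.
have -> : u + p ^+ (absz m).+1 * t = u * (1 + p ^+ (absz m).+1 * (v * t)).
  by rewrite mulrDr mulr1 mulrCA [u * (v * t)]mulrA uv mul1r.
rewrite [val _]rmorphM chiM ?integer_unitE ?residueD_pX ?rmorph1 ?oner_neq0 //.
by rewrite (@one_mod _ _ (v * t) _ _ erefl) ?mulr1 //; lia.
Qed.

Lemma character_mod_inv c chi : character_mod c chi ->
  character_mod c (fun z => (chi z)^-1).
Proof.
move=> [h1 h2 h3 h4 h5]; split=> // [u v u0 v0|u u0|u t u0|].
- by rewrite h1 // invfM.
- by rewrite normcV h2 // invr1.
- by rewrite h3.
- by rewrite h4 invr0.
Qed.

Section Fixed.
Variables (c : nat) (chi : K -> R[i]).
Hypothesis chi_mod : character_mod c chi.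

(** The integrand chi(ac a) |a|^s of a local zeta function in one variable. *)
Definition quasichar s a :=
  chi (angular_component p (val a)) * cpow (abs_val R (val a)) s.

(** The coefficient of q^(- b s) in [quasichar]; for the character chi^-1 it is the
    factor of the integrand that depends on g in the coefficient C_b. *)
Definition char_on b a := if ord b a then chi (angular_component p (val a)) else 0.

Lemma quasichar0 s : quasichar s 0 = 0.
Proof. by rewrite /quasichar /abs_val eqxx /cpow eqxx mulr0. Qed.

Lemma quasichar_ord s m u : res u != 0 ->
  quasichar s (p ^+ m * u) = chi (val u) * cpow q (- s) ^+ m.
Proof.
move=> u0; rewrite /quasichar angular_component_ord // abs_val_ord //.
by rewrite cpow_exprz // residue_card_gt0.
Qed.

Lemma char_on_ord m u : res u != 0 -> char_on m (p ^+ m * u) = chi (val u).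
Proof.
move=> u0; rewrite /char_on angular_component_ord //.
by case: ordP => // -[]; exists u.
Qed.

Lemma char_on_neq b m a : ord m a -> b != m -> char_on b a = 0.
Proof.
move=> om bm; rewrite /char_on; case: ifP => // ob.
by rewrite (ord_inj ob om) eqxx in bm.
Qed.

Lemma char_on_norm b a : normc (char_on b a) <= 1.
Proof.
rewrite /char_on; case: ordP => [[u -> u0]|_]; last by rewrite normc0.
by rewrite angular_component_ord //; case: chi_mod => _ -> //.
Qed.

Lemma quasichar_char_on s b a : ord b a -> quasichar s a = char_on b a * cpow q (- s) ^+ b.
Proof. by move=> /ordP[u -> u0]; rewrite quasichar_ord // char_on_ord. Qed.

Lemma quasichar_expand s B a : ~~ dvd_unif B a ->
  quasichar s a = \sum_(b < B) char_on b a * cpow q (- s) ^+ b.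
Proof.
move=> /ord_lt[m om mB]; rewrite (bigD1 (Ordinal mB)) //= -quasichar_char_on //.
rewrite big1 ?addr0 // => i im; rewrite (char_on_neq om) ?mul0r //.
Qed.

Local Notation rho s := (normc (cpow q (- s))).

Lemma rho_ge0 s : 0 <= rho s. Proof. exact: normc_ge0. Qed.

Lemma rho_lt1 s : 0 < complex.Re s -> rho s < 1.
Proof.
move=> s0; rewrite normc_cpow ?residue_card_gt0 // /powR gt_eqF ?residue_card_gt0 //.
rewrite expR_lt1 raddfN mulNr oppr_lt0 mulr_gt0 //.
by rewrite ln_gt0 // residue_card_gt1.
Qed.

Lemma quasichar_norm s m a : 0 < complex.Re s -> dvd_unif m a ->
  normc (quasichar s a) <= rho s ^+ m.
Proof.
move=> s0 /ord_ge[->|[m' /ordP[u -> u0] mm']].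
  by rewrite quasichar0 normc0 exprn_ge0 // rho_ge0.
rewrite quasichar_ord // normcM normcX; case: chi_mod => _ -> // _ _ _.
by rewrite mul1r ler_wiXn2l // ?rho_ge0 // ltW // rho_lt1.
Qed.

Lemma quasichar_norm1 s a : 0 < complex.Re s -> normc (quasichar s a) <= 1.
Proof. by move=> s0; rewrite -(expr0 (rho s)) quasichar_norm // dvd_unif0. Qed.

Lemma quasichar_stable s m a t : ~~ dvd_unif m.+1 a ->
  quasichar s (a + p ^+ (m + c) * t) = quasichar s a.
Proof.
move=> /ord_lt[m' /ordP[u -> u0] mm'].
have [_ _ h _ c0] := chi_mod.
have -> : p ^+ m' * u + p ^+ (m + c) * t = p ^+ m' * (u + p ^+ c * (p ^+ (m - m') * t)).
  by rewrite mulrDr !mulrA -!exprD; congr (_ + p ^+ _ * _); lia.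
by rewrite !quasichar_ord ?residueD_pX // h.
Qed.

Lemma char_on_stable b a t : char_on b (a + p ^+ (b + c) * t) = char_on b a.
Proof.
have [_ _ h _ c0] := chi_mod.
have -> : a + p ^+ (b + c) * t = a + p ^+ b * (p ^+ c * t) by rewrite exprD mulrA.
rewrite /char_on; case: ordP => [[u e u0]|no]; case: ordP => [[v e' v0]|no'] //.
- rewrite e e' !angular_component_ord //.
  have -> : u = v + p ^+ c * t; last by rewrite h.
  apply/eqP; rewrite -subr_eq0; apply/eqP; apply: (@uniformizerX_lreg _ _ p_unif b).
  by rewrite mulrBr -e e'; ring.
- case: no'; exists (u - p ^+ c * t); first by rewrite mulrBr -e addrK.
  by rewrite -mulrN residueD_pX.
- by case: no; exists (v + p ^+ c * t); rewrite ?residueD_pX // e' mulrDr.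
Qed.

(** [quasichar] is not locally constant at 0, but it is small there: this is why
    it is uniformly continuous. *)
Lemma quasichar_uniform s L a t : 0 < complex.Re s -> (c <= L)%N ->
  normc (quasichar s (a + p ^+ L * t) - quasichar s a) <= 2 * rho s ^+ (L - c).
Proof.
move=> s0 cL; have [dv|ndv] := boolP (dvd_unif (L - c).+1 a); last first.
  rewrite -{1}(subnK cL) quasichar_stable // subrr normc0.
  by rewrite mulr_ge0 // exprn_ge0 // rho_ge0.
have dv' : dvd_unif (L - c) a by apply: (dvd_unif_le p_unif) dv.
apply: le_trans (le_normcB _ _) _; rewrite mulr2n mulrDl mul1r lerD //.
  by apply: quasichar_norm => //; rewrite (dvd_unif_addr p_unif) // dvd_unif_pmul // leq_subr.
exact: quasichar_norm.
Qed.

(** A locally constant approximation of [quasichar], to which the exact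
    equidistribution statements apply. *)
Definition truncated s M a := if dvd_unif M a then 0 else quasichar s a.

Lemma truncated_close s M a : 0 < complex.Re s ->
  normc (quasichar s a - truncated s M a) <= rho s ^+ M.
Proof.
move=> s0; rewrite /truncated; case: ifP => [Ma|_].
  by rewrite subr0 quasichar_norm.
by rewrite subrr normc0 exprn_ge0 ?rho_ge0.
Qed.

Lemma truncated_stable s M a t : truncated s M (a + p ^+ (M + c) * t) = truncated s M a.
Proof.
rewrite /truncated (dvd_unif_addr p_unif) ?dvd_unif_pmul ?leq_addr //.
case: ifP => // /negbT ndv; rewrite quasichar_stable //.
by apply: contra ndv; exact: (dvd_unif_le p_unif).
Qed.

Lemma truncated_stable_ord s M m a t : ord m a ->
  truncated s M (a + p ^+ (m + c) * t) = truncated s M a.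
Proof.
move=> om; have [_ _ _ _ c0] := chi_mod; rewrite /truncated.
rewrite quasichar_stable; last by case/andP: om.
suff -> : dvd_unif M (a + p ^+ (m + c) * t) = dvd_unif M a by [].
case: (leqP M m) => Mm.
  by rewrite (dvd_unif_addr p_unif) // dvd_unif_pmul // (leq_trans Mm) // leq_addr.
have h b : ord m b -> dvd_unif M b = false.
  by move=> /andP[_ nb]; apply: contraNF nb; exact: (dvd_unif_le p_unif).
rewrite !h //; case/ordP: om => u -> u0; apply/ordP.
by exists (u + p ^+ c * t); rewrite ?residueD_pX // mulrDr mulrA exprD.
Qed.

End Fixed.
End Characters.

(** * Taylor expansion, and cancellation in one variable *)

Section MPoly.
Variables (n : nat).

Lemma mpoly_rect_closed (A : comNzRingType) (P : mpoly n A -> Prop) :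
  (forall c, P (mpolyC n c)) -> (forall i, P (mpolyX A (mnm1 i))) ->
  (forall h1 h2, P h1 -> P h2 -> P (h1 + h2)) ->
  (forall h1 h2, P h1 -> P h2 -> P (h1 * h2)) -> forall h, P h.
Proof.
move=> PC PX PD PM; have P1 : P 1 by rewrite -mpolyC1.
apply: mpolyind; first by rewrite -(mpolyC0 n A).
move=> c m h _ _ Ph; apply: PD => //; rewrite -mul_mpolyC; apply: (PM) => //.
rewrite mpolyXE_id; apply: (big_ind P) => [//|x y|i _]; first exact: PM.
elim: (m i) => [|k IH]; first by rewrite expr0.
by rewrite exprS; apply: (PM); first exact: PX.
Qed.

(** Used for the reduction modulo p and
    for the inclusion of the integers in the field. *)
Lemma meval_morph (A B : comNzRingType) (phi : {rmorphism A -> B}) v (h : mpoly n A) :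
  phi (meval v h) = meval (fun i => phi (v i)) (map_mpoly phi h).
Proof.
elim/mpoly_rect_closed: h => [c|i|h1 h2 e1 e2|h1 h2 e1 e2].
- by rewrite map_mpolyC !mevalC.
- by rewrite map_mpolyX !mevalXU.
- by rewrite !rmorphD /= e1 e2.
- by rewrite !rmorphM /= e1 e2.
Qed.

Lemma mderiv_morph (A B : comNzRingType) (phi : {rmorphism A -> B}) i (h : mpoly n A) :
  map_mpoly phi (mderiv i h) = mderiv i (map_mpoly phi h).
Proof.
elim/mpoly_rect_closed: h => [c|j|h1 h2 e1 e2|h1 h2 e1 e2].
- by rewrite map_mpolyC !mderivC rmorph0.
- by rewrite map_mpolyX !mderivX map_mpolyZ map_mpolyX rmorph_nat.
- by rewrite mderivD !rmorphD /= mderivD e1 e2.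
- by rewrite mderivM rmorphD !rmorphM /= mderivM e1 e2.
Qed.

Lemma meval_taylor (A : comNzRingType) (h : mpoly n A) (u v : 'I_n -> A) (e : A) :
  exists w, meval (fun i => u i + e * v i) h =
    meval u h + e * (\sum_i v i * meval u (mderiv i h)) + e ^+ 2 * w.
Proof.
elim/mpoly_rect_closed: h => [c|j|h1 h2 [w1 e1] [w2 e2]|h1 h2 [w1 e1] [w2 e2]].
- exists 0; rewrite !mevalC big1 => [|i _]; first by rewrite !mulr0 !addr0.
  by rewrite mderivC meval0 mulr0.
- exists 0; rewrite !mevalXU (bigD1 j) //= big1 => [|i ij].
    rewrite mderivX mevalZ mnm1E eqxx mevalX big1 => [|i _].
      by rewrite mulr1 mulr1 addr0 mulr0 addr0.
    by rewrite mnmBE subnn expr0.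
  by rewrite mderivX mevalZ mnm1E eq_sym (negPf ij) mul0r mulr0.
- exists (w1 + w2); rewrite !mevalD e1 e2.
  under [X in _ = _ + _ * X + _]eq_bigr do rewrite mderivD mevalD mulrDr.
  by rewrite big_split /=; ring.
- set s1 := \sum_i _ in e1; set s2 := \sum_i _ in e2.
  exists (w1 * meval u h2 + w2 * meval u h1 + s1 * s2
          + e * (s1 * w2 + s2 * w1) + e ^+ 2 * w1 * w2).
  rewrite !mevalM e1 e2.
  under [X in _ = _ + _ * X + _]eq_bigr do rewrite mderivM mevalD !mevalM mulrDr mulrA mulrCA.
  by rewrite big_split /= -mulr_suml -mulr_sumr -/s1 -/s2; ring.
Qed.

Lemma meval_cong (A : comNzRingType) (h : mpoly n A) (u v : 'I_n -> A) (e : A) :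
  exists w, meval (fun i => u i + e * v i) h = meval u h + e * w.
Proof.
have [w ->] := meval_taylor h u v e.
by exists (\sum_i v i * meval u (mderiv i h) + e * w); ring.
Qed.

End MPoly.

Section Cancellation.
Variables (R : realType) (K : localFieldType) (p : integers K).
Hypothesis p_unif : is_uniformizer p.
Local Notation A := (integers K).
Local Notation res := (@residue K).
Local Notation q := (residue_card K).
Variables (c : nat) (chi : K -> R[i]).
Hypothesis chi_mod : character_mod p c chi.

(** Multiplying a power series in y by 1 - kappa y. *)
Definition diff_seq (kappa : R[i]) (C : nat -> R[i]) (b : nat) :=
  C b - kappa * (if b is b'.+1 then C b' else 0).

(** The constant kappa for which (1 - kappa y) times the power series in y has
    rapidly decreasing coefficients: 0 if chi is nontrivial on the units, 1/q if it
    is trivial. *)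
Definition cancelling (kappa : R[i]) :=
  (kappa = 0 /\ exists2 u : A, res u != 0 & chi (val u) != 1) \/
  (kappa = q%:R^-1 /\ forall u : A, res u != 0 -> chi (val u) = 1).

Lemma char_on_unit b (l a : A) : res l != 0 ->
  char_on p chi b (l * a) = chi (val l) * char_on p chi b a.
Proof.
have [chiM _ _ _ _] := chi_mod.
move=> l0; rewrite /char_on; case: (ordP p_unif) => [[u e u0]|no];
  case: (ordP p_unif) => [[v e' v0]|no'].
- rewrite e e' !angular_component_ord // -chiM //; congr (chi (val _)).
  apply/eqP; rewrite -subr_eq0; apply/eqP; apply: (@uniformizerX_lreg _ _ p_unif b).
  by rewrite mulrBr -e e'; ring.
- case: no'; have [l' ll' l'0] := residue_inv l0.
  exists (l' * u); last by rewrite rmorphM mulf_neq0.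
  by rewrite mulrCA -e mulrA [l' * l]mulrC ll' mul1r.
- by case: no; exists (l * v); rewrite ?rmorphM ?mulf_neq0 // e' mulrCA.
- by rewrite mulr0.
Qed.

Lemma char_on_triv b (a : A) : (forall u : A, res u != 0 -> chi (val u) = 1) ->
  char_on p chi b a = (dvd_unif b a)%:R - (dvd_unif b.+1 a)%:R.
Proof.
move=> triv; rewrite /char_on; case: (ordP p_unif) => [[u -> u0]|].
  by rewrite angular_component_ord // triv // dvd_unifS // (negPf u0) dvd_unif_pmul // subr0.
move=> no; case: (boolP (dvd_unif b a)) => [ba|nba]; last first.
  rewrite (_ : dvd_unif b.+1 a = false) ?subr0 //.
  by apply: contraNF nba; exact: (dvd_unif_le p_unif).
case: (boolP (dvd_unif b.+1 a)) => [_|nba]; first by rewrite subrr.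
by case: no; apply/(ordP p_unif); rewrite /ord ba nba.
Qed.

Lemma char_diff_stable_le kappa L b (a t : A) : (b + c <= L)%N ->
  diff_seq kappa (fun b => char_on p chi b (a + p ^+ L * t)) b =
  diff_seq kappa (fun b => char_on p chi b a) b.
Proof.
have st b' : (b' + c <= L)%N -> char_on p chi b' (a + p ^+ L * t) = char_on p chi b' a.
  by move=> /subnKC <-; rewrite exprD -mulrA (char_on_stable p_unif chi_mod).
move=> bL; rewrite /diff_seq st //; case: b bL => [|b] bL //.
by rewrite st // (leq_trans _ bL) // leq_add2r.
Qed.

(** Here the two cases of the theorem part. For a nontrivial chi, multiplying t by a
    unit u with chi(u) != 1 multiplies the average by chi(u). For the trivial one,
    the measure of ord = j is q^-j - q^-(j+1), so that consecutive terms cancel. *)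
Lemma char_diff_cancel kappa N b M (a : A) :
  cancelling kappa -> (N < b)%N -> (b + c <= M)%N ->
  avg p M (fun t : 'rV[A]_1 =>
     diff_seq kappa (fun b => char_on p chi b (p ^+ N * (a + t 0 0))) b) = 0.
Proof.
move=> canc Nb bM.
pose Th (t : 'rV[A]_1) := diff_seq kappa (fun b => char_on p chi b (p ^+ N * t 0 0)) b.
have inv : invariant_mod p M Th.
  move=> x t; rewrite /Th mxE mxE.
  have e : p ^+ N * (x 0 0 + p ^+ M * t 0 0) =
    p ^+ N * x 0 0 + p ^+ M * (p ^+ N * t 0 0) by ring.
  by rewrite e char_diff_stable_le.
transitivity (avg p M Th).
  rewrite -(avg_shift p_unif (a *: const_mx 1) inv); apply: avg_ext => t.
  by rewrite /Th mxE mxE mxE mulr1 addrC.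
case: canc => [[k0 [l l0 chil]]|[k0 triv]].
  have ThE (t : 'rV[A]_1) : Th t = char_on p chi b (p ^+ N * t 0 0).
    by rewrite /Th /diff_seq k0 mul0r subr0.
  have: avg p M Th = chi (val l) * avg p M Th.
    rewrite -avgZ -(@avg_reindex _ _ p_unif _ _ _ _ (fun t => l *: t) inv); last first.
      move=> x y t e; have [l' ll' _] := residue_inv l0; exists (l' *: t).
      have h (w : 'rV[A]_1) : l' *: (l *: w) = w by rewrite scalerA mulrC ll' scale1r.
      by rewrite -(h x) e scalerDr h !scalerA mulrC.
    apply: avg_ext => t; rewrite !ThE mxE -char_on_unit //; congr char_on; ring.
  move/eqP; rewrite -subr_eq0 -{1}(mul1r (avg _ _ _)) -mulrBl mulf_eq0.
  by rewrite subr_eq0 eq_sym (negPf chil) /= => /eqP.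
have [_ _ _ _ c0] := chi_mod.
case: b Nb bM @Th inv => // b Nb bM Th inv.
have e b' : (N <= b')%N -> (b' <= M)%N ->
    avg p M (fun t : 'rV[A]_1 => (dvd_unif b' (p ^+ N * t 0 0))%:R : R[i]) = q%:R ^- (b' - N).
  move=> Nb' b'M; rewrite -(@avg_box1 _ _ p_unif _ 1 M 0); last by lia.
  by apply: avg_ext => t; rewrite -{1}(subnKC Nb') dvd_unifM.
transitivity (q%:R ^- (b.+1 - N) - q%:R ^- (b.+2 - N)
              - kappa * (q%:R ^- (b - N) - q%:R ^- (b.+1 - N))).
  rewrite -!e; [|lia..].
  rewrite -!avgB -avgZ -avgB; apply: avg_ext => t.
  by rewrite /Th /diff_seq !char_on_triv //; ring.
rewrite k0 !subSn ?exprS ?invfM; try lia.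
by ring.
Qed.

End Cancellation.

(** * Cancellation near a nondegenerate point *)

Section LocalCancellation.
Variables (R : realType) (K : localFieldType) (p : integers K).
Hypothesis p_unif : is_uniformizer p.
Local Notation A := (integers K).
Local Notation res := (@residue K).
Variables (n c : nat) (chi1 chi2 : K -> R[i]).
Hypotheses (chi1_mod : character_mod p c chi1) (chi2_mod : character_mod p c chi2).

Definition eval_row (h : {mpoly A[n]}) (x : 'rV[A]_n) : A := meval (fun i => x 0 i) h.

(** The condition of nondegeneracy at one point, for one pair of reduced
    polynomials. *)
Definition regular_system (h : 'I_2 -> {mpoly (@residue_field K)[n]})
    (z : 'I_n -> @residue_field K) :=
  forall I : {set 'I_2}, I != finset.set0 ->
    (forall i, meval z (h i) = 0 <-> i \in I) ->
    \rank (\matrix_(i < #|I|, j < n) meval z (mderiv j (h (enum_val i)))) = #|I|.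

Definition nondegenerate_at (F G : {mpoly A[n]}) :=
  regular_system (fun i => map_mpoly res (tnth [tuple F; G] i)).

Lemma eval_row_taylor h (x t : 'rV[A]_n) (e : A) : exists w,
  eval_row h (x + e *: t) = eval_row h x
    + e * (\sum_j t 0 j * eval_row (mderiv j h) x) + e ^+ 2 * w.
Proof.
have [w ew] := meval_taylor h (fun i => x 0 i) (fun i => t 0 i) e.
exists w; rewrite -ew; apply: meval_eq => i; by rewrite !mxE.
Qed.

Lemma eval_row_cong h (x t : 'rV[A]_n) (e : A) : exists w,
  eval_row h (x + e *: t) = eval_row h x + e * w.
Proof.
have [w ew] := meval_cong h (fun i => x 0 i) (fun i => t 0 i) e.
exists w; rewrite -ew; apply: meval_eq => i; by rewrite !mxE.
Qed.

Lemma res_eval_row h (x : 'rV[A]_n) :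
  res (eval_row h x) = meval (fun i => res (x 0 i)) (map_mpoly res h).
Proof. exact: meval_morph. Qed.

Lemma char_diff0 kappa N b (a : A) : (N < b)%N -> ~~ dvd_unif N a ->
  diff_seq kappa (fun b => char_on p chi2 b a) b = 0.
Proof.
have h b' : (N <= b')%N -> ~~ dvd_unif N a -> char_on p chi2 b' a = 0.
  move=> Nb nd; rewrite /char_on; case: ifP => // /andP[ba _].
  by case/negP: nd; exact: (dvd_unif_le p_unif Nb).
move=> Nb nd; rewrite /diff_seq h //; last exact: ltnW.
by case: b Nb => // b Nb; rewrite h // mulr0 subr0.
Qed.

Lemma char_diff_lt kappa e b (a : A) : (b < e)%N -> dvd_unif e a ->
  diff_seq kappa (fun b => char_on p chi2 b a) b = 0.
Proof.
have h b' : (b' < e)%N -> dvd_unif e a -> char_on p chi2 b' a = 0.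
  move=> be ea; rewrite /char_on; case: ifP => // /andP[_ /negP nd].
  by case: nd; exact: (dvd_unif_le p_unif be).
move=> be ea; rewrite /diff_seq h //.
by case: b be => [|b] be; rewrite ?h // ?mulr0 ?subr0 //; apply: ltnW.
Qed.

(** The function t |-> (F, G)(u0 + p^c t), or G alone if F does not vanish modulo p
    at u0, is a submersion modulo p by nondegeneracy. Its average is thus computed
    on the target, where the coordinate of G can be averaged first, by
    [char_diff_cancel]. *)
Lemma local_cancel (F G : {mpoly A[n]}) (u0 : 'rV[A]_n) (kappa s : R[i]) d e b M0 M :
  nondegenerate_at F G (fun i => res (u0 0 i)) ->
  cancelling chi2 kappa -> (e + c < b)%N -> (b + M0 + c <= M)%N ->
  avg p M (fun t : 'rV[A]_n =>
    truncated p chi1 s M0 (p ^+ d * eval_row F (u0 + p ^+ c *: t)) *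
    diff_seq kappa (fun b => char_on p chi2 b (p ^+ e * eval_row G (u0 + p ^+ c *: t))) b)
  = 0.
Proof.
move=> nondeg canc ecb bM; have [_ _ _ _ c0] := chi2_mod.
pose h i := tnth [tuple F; G] i.
pose z i := res (u0 0 i).
pose I := finset (fun i : 'I_2 => meval z (map_mpoly res (h i)) == 0).
have resh i x : res (eval_row (h i) (u0 + p ^+ c *: x)) = meval z (map_mpoly res (h i)).
  have [w ->] := eval_row_cong (h i) u0 x (p ^+ c).
  by rewrite residueD_pX // res_eval_row.
(* if G(u0) is a unit, ord (p^e G) = e is too small for b *)
have [I1|I1] := boolP (ord_max \in I); last first.
  rewrite -[RHS](avg_cst p n M); apply: avg_ext => t.
  rewrite (@char_diff0 _ (e + c)) ?mulr0 //.
  rewrite dvd_unifM //; apply: contra I1; rewrite inE -(resh _ t).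
  rewrite (_ : h ord_max = G) // => cG.
  have /(dvd_unifP p_unif)[w ->] : dvd_unif 1 (eval_row G (u0 + p ^+ c *: t)).
    exact: (dvd_unif_le p_unif c0 cG).
  by rewrite rmorphM (residueP p_unif) mul0r.
pose r := #|I|.
pose H (t : 'rV[A]_n) : 'rV[A]_r := \row_i eval_row (h (enum_val i)) (u0 + p ^+ c *: t).
pose J := \matrix_(i < #|I|, j < n)
  meval z (mderiv j (map_mpoly res (h (enum_val i)))).
have rankI : \rank J = #|I|.
  apply: nondeg => [|i]; first by apply/set0Pn; exists ord_max.
  by rewrite inE; split=> /eqP.
have /row_freeP[B JB] : row_free J.
  by rewrite -row_leq_rank rankI.
(* a right inverse modulo p of the Jacobian matrix *)
pose D (w : 'rV[A]_r) : 'rV[A]_n := w *m (map_mx residue_lift B)^T.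
have Hc N t v : exists u, H (t + p ^+ N *: v) = H t + p ^+ (c + N) *: u.
  have /fin_all_exists[u ue] : forall i : 'I_r, exists u,
      H (t + p ^+ N *: v) 0 i = H t 0 i + p ^+ (c + N) * u.
    move=> i; rewrite !mxE scalerDr scalerA -exprD addrA; exact: eval_row_cong.
  by exists (\row_i u i); apply/rowP => i; rewrite ue !mxE.
have HD N t w : exists u,
    H (t + p ^+ N *: D w) = H t + p ^+ (c + N) *: w + p ^+ (c + N).+1 *: u.
  have /fin_all_exists[u ue] : forall i : 'I_r, exists u,
      H (t + p ^+ N *: D w) 0 i = H t 0 i + p ^+ (c + N) * w 0 i + p ^+ (c + N).+1 * u.
    move=> i; rewrite !mxE scalerDr scalerA -exprD addrA.
    have [v ->] := eval_row_taylor (h (enum_val i)) (u0 + p ^+ c *: t) (D w) (p ^+ (c + N)).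
    set S := \sum_j _.
    have /(residue_eq0P p_unif)[s' es] : res (S - w 0 i) = 0.
      rewrite rmorphB; apply/eqP; rewrite subr_eq0; apply/eqP.
      rewrite /S rmorph_sum /=.
      transitivity ((map_mx res w *m (J *m B)^T) 0 i); last first.
        by rewrite JB trmx1 mulmx1 mxE.
      rewrite trmx_mul mulmxA mxE; apply: eq_bigr => j _.
      rewrite rmorphM; congr (_ * _).
        rewrite !mxE rmorph_sum; apply: eq_bigr => k _.
        by rewrite !mxE rmorphM /= residue_liftK.
      rewrite !mxE; have [v' ->] := eval_row_cong (mderiv j (h (enum_val i))) u0 t (p ^+ c).
      by rewrite residueD_pX // res_eval_row mderiv_morph.
    exists (s' + p ^+ (c + N).-1 * v).
    rewrite -(subrK (w 0 i) S) es.
    have -> : (p ^+ (c + N)) ^+ 2 = p ^+ (c + N).+1 * p ^+ (c + N).-1.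
      by rewrite -exprM -exprD; congr (_ ^+ _); lia.
    by rewrite exprS; ring.
  exists (\row_i u i); apply/rowP => i; by rewrite ue !mxE.
pose i1 := enum_rank_in I1 ord_max.
have i1E : enum_val i1 = ord_max by rewrite enum_rankK_in.
(* If F(u0) is a unit then F is no coordinate of H, but the factor of f is
   constant around u0. *)
pose phi (y : 'rV[A]_r) := truncated p chi1 s M0
   (p ^+ d * (if ord0 \in I then y 0 (enum_rank_in I1 ord0) else eval_row F u0)).
pose Th (y : 'rV[A]_r) := phi y *
   diff_seq kappa (fun b => char_on p chi2 b (p ^+ e * y 0 i1)) b.
have tr_le a t L : (M0 + c <= L)%N ->
    truncated p chi1 s M0 (a + p ^+ L * t) = truncated p chi1 s M0 a.
  by move=> /subnKC <-; rewrite exprD -mulrA (truncated_stable p_unif chi1_mod).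
have invTh : invariant_mod p (c + M) Th.
  move=> x t; rewrite /Th /phi !mxE; congr (_ * _); last first.
    rewrite mulrDr mulrCA (char_diff_stable_le p_unif chi2_mod) //; lia.
  by case: ifP => // _; rewrite ?mxE mulrDr mulrCA tr_le //; lia.
rewrite (avg_ext _ _ (_ : _ =1 fun t => Th (H t))); last first.
  move=> t; rewrite /Th /phi !mxE i1E; congr (_ * _).
  case: ifP => [I0|/negbT I0]; first by rewrite ?mxE enum_rankK_in.
  have [w ->] := eval_row_cong F u0 t (p ^+ c).
  rewrite mulrDr mulrA -exprD (truncated_stable_ord p_unif chi1_mod) //.
  apply/(ordP p_unif); exists (eval_row F u0) => //.
  by move: I0; rewrite inE -(resh _ 0) scaler0 addr0.
rewrite (avg_submersion p_unif Hc HD invTh).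
have H01 : H 0 0 i1 = eval_row G u0 by rewrite mxE i1E scaler0 addr0.
move: (H 0) H01 => H0 H01.
(* if p^c does not divide G(u0), again ord (p^e G) is too small for b *)
have [/(dvd_unifP p_unif)[a aE]|ndv] := boolP (dvd_unif c (eval_row G u0)); last first.
  rewrite -[RHS](avg_cst p r M); apply: avg_ext => y.
  rewrite /Th (@char_diff0 _ (e + c)) ?mulr0 // dvd_unifM // mxE H01 mxE.
  by rewrite (dvd_unif_addr p_unif) // dvd_unif_pmul.
apply: (avg_coord0 (i := i1) p_unif).
  move=> x t; rewrite scalerDr scalerA -exprD addrA; exact: invTh.
move=> y; rewrite (avg_ext _ _ (_ : _ =1 fun t : 'rV[A]_1 => phi (H0 + p ^+ c *: y) *
  diff_seq kappa (fun b => char_on p chi2 b (p ^+ (e + c) * ((a + y 0 i1) + t 0 0))) b)).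
  by rewrite avgZ (char_diff_cancel p_unif chi2_mod) ?mulr0 //; lia.
move=> t.
have -> : Th (H0 + p ^+ c *: (y + t 0 0 *: delta_mx 0 i1)) =
    phi (H0 + p ^+ c *: (y + t 0 0 *: delta_mx 0 i1)) *
    diff_seq kappa (fun b => char_on p chi2 b (p ^+ (e + c) * ((a + y 0 i1) + t 0 0))) b.
  rewrite /Th (_ : p ^+ e * _ = p ^+ (e + c) * ((a + y 0 i1) + t 0 0)) //.
  by rewrite mxE H01 aE !mxE !eqxx mulr1 exprD; ring.
have -> // : phi (H0 + p ^+ c *: (y + t 0 0 *: delta_mx 0 i1)) = phi (H0 + p ^+ c *: y).
rewrite /phi; case: ifP => [I0|_]; last exact: erefl.
set j := enum_rank_in I1 ord0.
have ji : (j == i1) = false.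
  by apply/negbTE/eqP => /(congr1 enum_val); rewrite i1E enum_rankK_in.
by rewrite !mxE ji andbF mulr0 addr0.
Qed.

End LocalCancellation.

(** * Integrals as limits of averages *)

Section RiemannSums.
Variables (R : realType) (K : localFieldType) (p : integers K) (n : nat).
Hypothesis p_unif : is_uniformizer p.
Variable mu : {measure set (borel_space K n) -> \bar R}.
Hypothesis mu_haar : is_normalized_haar mu.
Local Notation A := (integers K).

Definition embed (x : 'rV[A]_n) : borel_space K n := map_mx val x.

Definition box L (a : 'rV[A]_n) : set (borel_space K n) :=
  [set x | exists t, x = embed (a + p ^+ L *: t)].

Local Notation D := (@integral_points K n).

Lemma embed_near L (a : 'rV[A]_n) (x : 'rV[K]_n) :
  (forall i, x 0 i - embed a 0 i \in val_ge L%:Z) ->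
  exists t, x = embed (a + p ^+ L *: t).
Proof.
move=> h; have /fin_all_exists[t tE] :
    forall i, exists t : A, x 0 i = val (a 0 i + p ^+ L * t).
  move=> i; have := h i; rewrite mxE => hi.
  have hi0 : x 0 i - val (a 0 i) \in val_ge 0.
    move: hi; rewrite !unfold_in => /orP[->//|hi].
    by apply/orP; right; apply: le_trans hi.
  have [t ti] := @val_geP _ _ p_unif L (Integers hi0) hi.
  by exists t; rewrite -ti rmorphD /= addrC subrK.
exists (\row_i t i); apply/rowP => i; by rewrite mxE tE !mxE.
Qed.

Lemma box_open L a : local_open (box L a).
Proof.
move=> _ [t ->]; exists L%:Z => x /embed_near[u ->].
by exists (t + u); rewrite -addrA -scalerDr.
Qed.

Lemma box_measurable L a : measurable (box L a).
Proof. by apply: sub_sigma_algebra; exact: box_open. Qed.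

Lemma integralP (x : 'rV[K]_n) : D x -> exists a, x = embed a.
Proof.
move=> Dx; have /fin_all_exists[t tE] : forall i, exists t : A, x 0 i = val t.
  by move=> i; exists (Integers (Dx i)).
by exists (\row_i t i); apply/rowP => i; rewrite tE !mxE.
Qed.

Lemma embed_integral a : D (embed a).
Proof. by move=> i; rewrite mxE; exact: valP. Qed.

Lemma integral_open (U : set (borel_space K n)) : (forall a, U (embed a) ->
  exists L, forall t, U (embed (a + p ^+ L *: t))) -> local_open (D `&` U).
Proof.
move=> h x [/integralP[a ->] /h[L UL]]; exists L%:Z => y /embed_near[u ->].
by split; [exact: embed_integral|exact: UL].
Qed.

Lemma integral_measurable : measurable D.
Proof.
rewrite -[D]setIT; apply: sub_sigma_algebra; apply: integral_open => a _.
by exists 0%N.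
Qed.

Lemma integral_boxes L : D = \big[setU/set0]_(v : classes K n L) box L (rep p v).
Proof.
apply/seteqP; split=> [x /integralP[a ->]|x].
  have [v [t ->]] := rep_surj p_unif L a.
  by rewrite -bigcup_seq; exists v; rewrite /= ?mem_index_enum //; exists t.
by rewrite -bigcup_seq => -[v _ [t ->]]; exact: embed_integral.
Qed.

Lemma box_disjoint L : trivIset setT (fun v : classes K n L => box L (rep p v)).
Proof.
move=> v w _ _ [_ [[t ->] [u /rowP e]]].
apply: (@rep_inj _ _ p_unif _ _ _ _ (u - t)).
have -> : rep p v = (rep p w + p ^+ L *: u) - p ^+ L *: t.
  apply/eqP; rewrite -subr_eq opprK; apply/eqP/rowP => i; apply: val_inj.
  by have := e i; rewrite !mxE.
by rewrite -addrA -scalerBr.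
Qed.

Lemma mu_box L a : mu (box L a) = mu (box L 0).
Proof.
have [inv _] := mu_haar.
rewrite -(inv (embed a) (box L 0)); last exact: box_measurable.
congr (mu _); apply/seteqP; split=> [_ [t ->]|_ [_ [t ->] <-]].
  exists (embed (p ^+ L *: t)); first by exists t; rewrite add0r.
  by apply/rowP => i; rewrite !mxE rmorphD /= addrC.
by exists t; apply/rowP => i; rewrite !mxE add0r rmorphD /= addrC.
Qed.

Definition uniformly_continuousR (h : 'rV[A]_n -> R) :=
  forall e : R, 0 < e -> exists L, forall x t, `|h (x + p ^+ L *: t) - h x| <= e.

Section RealFunction.
Variable h : borel_space K n -> R.
Hypothesis h_uc : uniformly_continuousR (fun x => h (embed x)).

Lemma uc_measurable : measurable_fun D h.
Proof.
apply: (measurability _ (RGenOInfty.measurableE R)) => _ [_ [r ->] <-].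
apply: sub_sigma_algebra; apply: integral_open => a /=.
rewrite in_itv /= andbT => ra; have e0 : 0 < (h (embed a) - r) / 2.
  by rewrite divr_gt0 // subr_gt0.
have [L hL] := h_uc e0; exists L => t; rewrite in_itv /= andbT.
have := hL a t; rewrite ler_norml => /andP[h1 _]; lra.
Qed.

Lemma uc_bounded : exists B, forall x, `|h (embed x)| <= B.
Proof.
have [L hL] := h_uc (@ltr01 R).
exists (\sum_(v : classes K n L) `|h (embed (rep p v))| + 1) => x.
have [v [t ->]] := rep_surj p_unif L x.
rewrite -[h _](subrK (h (embed (rep p v)))) addrC.
apply: le_trans (ler_normD _ _) _; apply: lerD => //.
by rewrite (bigD1 v) //= lerDl sumr_ge0.
Qed.

Lemma uc_integrable : mu.-integrable D (EFin \o h).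
Proof.
apply: measurable_bounded_integrable.
- exact: integral_measurable.
- by have [_ ->] := mu_haar; rewrite ltry.
- exact: uc_measurable.
have [B hB] := uc_bounded; exists B; split; first exact: num_real.
move=> M BM x Dx /=; have [a ->] := integralP Dx.
by apply: le_trans (hB a) _; exact: ltW.
Qed.

Lemma box_sub L (v : classes K n L) : box L (rep p v) `<=` D.
Proof. by move=> _ [t ->]; exact: embed_integral. Qed.

Lemma Rintegral_boxes L : Rintegral mu D h =
  \sum_(v : classes K n L) Rintegral mu (box L (rep p v)) h.
Proof.
rewrite /Rintegral {1}(integral_boxes L) integral_bigsetU_EFin.
- rewrite sum_fine // => v _; apply: integrable_fin_num; first exact: box_measurable.
  apply: integrableS uc_integrable; [exact: integral_measurable|exact: box_measurable|].
  exact: box_sub.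
- by move=> v; exact: box_measurable.
- exact: index_enum_uniq.
- exact: sub_trivIset (@box_disjoint L).
- by rewrite -integral_boxes; apply/measurable_EFinP; exact: uc_measurable.
Qed.

End RealFunction.

Lemma uc_cst r : uniformly_continuousR (fun=> r).
Proof. by move=> e e0; exists 0%N => x t; rewrite subrr normr0 ltW. Qed.

Lemma mu_box_fine L a : fine (mu (box L a)) = (#|classes K n L|%:R)^-1.
Proof.
have := @Rintegral_boxes (fun=> 1) (uc_cst 1) L.
rewrite Rintegral_cst ?mul1r; last exact: integral_measurable.
have [_ ->] := mu_haar; rewrite /= => e.
have c0 := card_classes_gt0 K R n L.
apply: (mulfI (lt0r_neq0 c0)); rewrite mulfV ?gt_eqF //.
rewrite [RHS]e mulr_natl -sumr_const; apply: eq_bigr => v _.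
by rewrite Rintegral_cst ?mul1r ?mu_box //; exact: box_measurable.
Qed.

(** The average at level L is the integral of the step function that is equal to h
    at the representatives. *)
Lemma riemann_sum_real (h : borel_space K n -> R) e L : 0 < e ->
  uniformly_continuousR (fun x => h (embed x)) ->
  (forall x t, `|h (embed (x + p ^+ L *: t)) - h (embed x)| <= e) ->
  `|Rintegral mu D h - avg p L (fun x => h (embed x))| <= e.
Proof.
move=> e0 huc hL; have c0 := card_classes_gt0 K R n L.
rewrite (Rintegral_boxes huc L) /avg mulr_sumr -sumrB.
have -> : e = \sum_(v : classes K n L) e * fine (mu (box L (rep p v))).
  rewrite -mulr_sumr; under eq_bigr do rewrite mu_box_fine.
  by rewrite sumr_const -[_^-1 *+ _]mulr_natl mulfV ?gt_eqF // mulr1.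
apply: le_trans (ler_norm_sum _ _ _) _; apply: ler_sum => v _.
rewrite mulrC -(mu_box_fine L (rep p v)) -Rintegral_cst; last exact: box_measurable.
have mB := box_measurable L (rep p v).
have fB : (mu (box L (rep p v)) < +oo)%E.
  apply: (@le_lt_trans _ _ (mu D)); last by have [_ ->] := mu_haar; rewrite ltry.
  by apply: le_measure; rewrite ?inE //; [exact: integral_measurable|exact: box_sub].
have ih : mu.-integrable (box L (rep p v)) (EFin \o h).
  by apply: integrableS (uc_integrable huc) => //; [exact: integral_measurable|exact: box_sub].
have ic r : mu.-integrable (box L (rep p v)) (EFin \o (fun=> r)).
  apply: measurable_bounded_integrable => //.
  by exists `|r|; split; [exact: num_real|move=> M rM x _ /=; exact: ltW].
rewrite -RintegralB // -Rintegral_cst //.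
have ihc : mu.-integrable (box L (rep p v)) (EFin \o (fun x => h x - h (embed (rep p v)))).
  exact: (integrableB mB ih (ic _)).
apply: le_trans (le_normr_Rintegral mB ihc) _; apply: le_Rintegral => //.
  exact: (integrable_norm ihc).
by move=> x [t ->]; exact: hL.
Qed.

Lemma Re_sum I (r : seq I) (F : I -> R[i]) :
  complex.Re (\sum_(i <- r) F i) = \sum_(i <- r) complex.Re (F i).
Proof. by elim/big_rec2: _ => // i x y _ <-; case: (F i); case: y. Qed.

Lemma Im_sum I (r : seq I) (F : I -> R[i]) :
  complex.Im (\sum_(i <- r) F i) = \sum_(i <- r) complex.Im (F i).
Proof. by elim/big_rec2: _ => // i x y _ <-; case: (F i); case: y. Qed.

Lemma avg_complex L (Th : 'rV[A]_n -> R[i]) :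
  avg p L Th = (avg p L (fun x => complex.Re (Th x))
                +i* avg p L (fun x => complex.Im (Th x)))%C.
Proof.
rewrite /avg -Re_sum -Im_sum; case: (\sum_v _) => a b.
rewrite -(rmorph_nat (@real_complex R)) -fmorphV.
apply/eqP; rewrite eq_complex /=; apply/andP; split; apply/eqP; ring.
Qed.

Lemma normc_ReIm (z : R[i]) : normc z <= `|complex.Re z| + `|complex.Im z|.
Proof.
rewrite {1}[z]complexE.
apply: le_trans (le_normcD _ _) _; rewrite normcM !normc_real lerD2l /=.
by rewrite expr0n /= add0r expr1n sqrtr1 mul1r.
Qed.

Lemma Re_le_normc (z : R[i]) : `|complex.Re z| <= normc z.
Proof. by rewrite -lecR -norm_normc; exact: normc_ge_Re. Qed.

Lemma Im_le_normc (z : R[i]) : `|complex.Im z| <= normc z.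
Proof.
case: z => a b /=; rewrite -sqrtr_sqr ler_wsqrtr // lerDr sqr_ge0 //.
Qed.

Lemma riemann_sum (h : borel_space K n -> R[i]) :
  (forall e : R, 0 < e -> exists L0, forall L, (L0 <= L)%N -> forall x t,
     normc (h (embed (x + p ^+ L *: t)) - h (embed x)) <= e) ->
  forall e : R, 0 < e -> exists L0, forall L, (L0 <= L)%N ->
    normc (complex_integral mu D h - avg p L (fun x => h (embed x))) <= e.
Proof.
move=> huc e e0; have e20 : 0 < e / 2 by rewrite divr_gt0.
have [L0 hL0] := huc _ e20; exists L0 => L L0L.
have hRe x t : `|complex.Re (h (embed (x + p ^+ L *: t))) - complex.Re (h (embed x))| <= e / 2.
  by rewrite -raddfB; apply: le_trans (Re_le_normc _) (hL0 _ L0L _ _).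
have hIm x t : `|complex.Im (h (embed (x + p ^+ L *: t))) - complex.Im (h (embed x))| <= e / 2.
  by rewrite -raddfB; apply: le_trans (Im_le_normc _) (hL0 _ L0L _ _).
have uRe : uniformly_continuousR (fun x => complex.Re (h (embed x))).
  move=> d d0; have [L1 hL1] := huc _ d0; exists L1 => x t.
  by rewrite -raddfB; apply: le_trans (Re_le_normc _) (hL1 _ (leqnn _) _ _).
have uIm : uniformly_continuousR (fun x => complex.Im (h (embed x))).
  move=> d d0; have [L1 hL1] := huc _ d0; exists L1 => x t.
  by rewrite -raddfB; apply: le_trans (Im_le_normc _) (hL1 _ (leqnn _) _ _).
apply: le_trans (normc_ReIm _) _; rewrite /complex_integral avg_complex /=.
rewrite [leRHS]splitr; apply: lerD.
  exact: (@riemann_sum_real (fun x => complex.Re (h x))).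
exact: (@riemann_sum_real (fun x => complex.Im (h x))).
Qed.

End RiemannSums.

(** * Newton polyhedra *)

Section Weights.
Variables (R : realType) (n : nat).

Definition weight (k : 'I_n -> nat) (m : multinom n) : nat := (\sum_i k i * m i)%N.

(** d is the minimum of <k, m> on the support of h, hence d(k, Gamma(h)). *)
Definition min_weight (A : comNzRingType) (k : 'I_n -> nat) (h : mpoly n A) (d : nat) :=
  (exists2 m, m \in msupp h & weight k m = d) /\
  (forall m, m \in msupp h -> (d <= weight k m)%N).

Lemma min_weight_exists (A : comNzRingType) k (h : mpoly n A) :
  h != 0 -> exists d, min_weight k h d.
Proof.
move=> h0; pose P d := has (fun m => weight k m == d) (msupp h).
have exP : exists d, P d.
  case e : (msupp h) => [|m s]; first by rewrite -msupp_eq0 e in h0.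
  by exists (weight k m); rewrite /P e /= eqxx.
case: (ex_minnP exP) => d /hasP[m mh /eqP md] min; exists d; split; first by exists m.
by move=> m' m'h; apply: min; apply/hasP; exists m'.
Qed.

Lemma dotp_exponent (k : 'I_n -> nat) m :
  dotp (\row_i (k i)%:R : 'rV[R]_n) (exponent R m) = (weight k m)%:R.
Proof.
rewrite /dotp /weight natr_sum; apply: eq_bigr => i _.
by rewrite !mxE natrM.
Qed.

Lemma newton_dotp_ge (A : comNzRingType) (k : 'I_n -> nat) (h : mpoly n A) (d : R) x :
  (forall m, m \in msupp h -> d <= (weight k m)%:R) ->
  newton_polyhedron R h x -> d <= dotp (\row_i (k i)%:R) x.
Proof.
move=> hd; pose H := [set x : 'rV[R]_n | d <= dotp (\row_i (k i)%:R) x].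
suff : newton_polyhedron R h `<=` H by apply.
apply: smallest_sub => [y z l|y [m /= mh [w w0 <-]]].
  rewrite !inE /H /= => yd zd.
  rewrite [X in _ <= X](_ : _ =
     l%:num * dotp (\row_i (k i)%:R) y + (1 - l%:num) * dotp (\row_i (k i)%:R) z); last first.
    rewrite /dotp !mulr_sumr -big_split; apply: eq_bigr => i _.
    by rewrite !mxE /= /unstable.onem mulrDr; congr (_ + _); rewrite mulrCA.
  have l0 : 0 <= l%:num by [].
  have l1 : 0 <= 1 - l%:num by rewrite subr_ge0.
  nra.
rewrite /H /= (_ : dotp _ _ =
    dotp (\row_i (k i)%:R) (exponent R m) + dotp (\row_i (k i)%:R) w).
  rewrite dotp_exponent -[d]addr0 lerD ?hd ?mcoeff_msupp //.
  by apply: sumr_ge0 => i _; rewrite mxE mulr_ge0.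
by rewrite /dotp -big_split; apply: eq_bigr => i _; rewrite !mxE mulrDr.
Qed.

Lemma newton_exponent (A : comNzRingType) (h : mpoly n A) m :
  m \in msupp h -> newton_polyhedron R h (exponent R m).
Proof.
move=> mh; apply: sub_gen_smallest; exists m; first by rewrite /= -mcoeff_msupp.
by exists 0; [move=> i; rewrite mxE | rewrite addr0].
Qed.

Lemma support_value_newton (A : comNzRingType) k (h : mpoly n A) d :
  min_weight k h d ->
  support_value (\row_i (k i)%:R : 'rV[R]_n) (newton_polyhedron R h) = d%:R.
Proof.
move=> [[m mh md] dmin]; apply/eqP; rewrite eq_le; apply/andP; split.
  rewrite -md -dotp_exponent; apply: ge_inf.
    exists d%:R => _ [x hx <-]; apply: newton_dotp_ge hx => m' m'h.
    by rewrite ler_nat dmin.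
  by exists (exponent R m) => //; exact: newton_exponent.
apply: lb_le_inf.
  exists (dotp (\row_i (k i)%:R) (exponent R m)), (exponent R m) => //.
  exact: newton_exponent.
move=> _ [x hx <-]; apply: newton_dotp_ge hx => m' m'h.
by rewrite ler_nat dmin.
Qed.

Lemma face_exponent (A : comNzRingType) k (h : mpoly n A) d m :
  min_weight k h d -> m \in msupp h ->
  face (\row_i (k i)%:R : 'rV[R]_n) (newton_polyhedron R h) (exponent R m) <->
  weight k m = d.
Proof.
move=> hd mh; rewrite /face /= (support_value_newton hd) dotp_exponent.
split=> [[_ /eqP]|->]; first by rewrite eqr_nat => /eqP.
by split=> //; exact: newton_exponent.
Qed.

Lemma weightD k m1 m2 : weight k (mnm_add m1 m2) = (weight k m1 + weight k m2)%N.
Proof.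
by rewrite /weight -big_split; apply: eq_bigr => i _; rewrite mnmDE mulnDr.
Qed.

(** The half-space <k, x> >= d + e is closed, and contains the Newton polyhedron of
    f * g because an exponent of f * g is a sum of exponents of f and g. *)
Lemma diagonal_bound (A : comNzRingType) (f g : mpoly n A) t0 k d e :
  closure (newton_polyhedron R (f * g)) (const_mx t0) ->
  min_weight k f d -> min_weight k g e ->
  (d + e)%:R <= t0 * (\sum_i k i)%:R.
Proof.
move=> t0cl [_ fd] [_ ge].
have -> : t0 * (\sum_i k i)%:R = dotp (\row_i (k i)%:R) (const_mx t0).
  by rewrite /dotp natr_sum mulr_sumr; apply: eq_bigr => i _; rewrite !mxE mulrC.
pose H := [set x : 'rV[R]_n | (d + e)%:R <= dotp (\row_i (k i)%:R) x].
have clH : closed H.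
  apply: (@closed_comp _ _ (dotp (\row_i (k i)%:R)) [set y : R | (d + e)%:R <= y]);
    last exact: closed_ge.
  move=> x _.
  (* Continuity of a linear form, by induction on its coordinates. *)
  suff sumC (s : seq 'I_n) : continuous_at x (fun y : 'rV[R]_n =>
      \sum_(i <- s) (\row_i (k i)%:R : 'rV[R]_n) 0 i * y 0 i) by exact: sumC.
  elim: s => [|i s IH].
    rewrite [F in continuous_at _ F](_ : _ = fun=> 0); first exact: cst_continuous.
    by apply/funext => y; rewrite big_nil.
  rewrite [F in continuous_at _ F](_ : _ = fun y : 'rV[R]_n =>
      (\row_i (k i)%:R : 'rV[R]_n) 0 i * y 0 i +
      \sum_(i <- s) (\row_i (k i)%:R : 'rV[R]_n) 0 i * y 0 i).
    rewrite /continuous_at; apply: cvgD; [exact: nbhs_filter| |exact: IH].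
    apply: cvgM; [exact: nbhs_filter| |exact: coord_continuous].
    by apply: cvg_cst; exact: nbhs_filter.
  by apply/funext => y; rewrite big_cons.
suff sub : newton_polyhedron R (f * g) `<=` H.
  have := closure_subset sub t0cl; rewrite -(closure_id H).1 //.
move=> x; apply: newton_dotp_ge => m /msuppM_le/allpairsP[[m1 m2] [m1f m2g ->]].
by rewrite weightD ler_nat leq_add ?fd ?ge.
Qed.

End Weights.

Section Initial.
Variables (R : realType) (K : localFieldType) (p : integers K) (n : nat).
Hypothesis p_unif : is_uniformizer p.
Local Notation A := (integers K).
Local Notation res := (@residue K).

Definition scale_row (k : 'I_n -> nat) (u : 'rV[A]_n) : 'rV[A]_n :=
  \row_i (p ^+ k i * u 0 i).

(** For d the minimum of <k, .> on the support of h, the polynomial F such that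
    h (p^k u) = p^d F (u). Truncated subtraction is exact on that support. *)
Definition rescaled (k : 'I_n -> nat) d (h : {mpoly A[n]}) : {mpoly A[n]} :=
  \sum_(m <- msupp h) (mcoeff m h * p ^+ (weight k m - d)) *: mpolyX A m.

Lemma eval_rescaled k d (h : {mpoly A[n]}) u : min_weight k h d ->
  eval_row h (scale_row k u) = p ^+ d * eval_row (rescaled k d h) u.
Proof.
move=> [_ dmin]; rewrite /eval_row mevalE /rescaled rmorph_sum mulr_sumr.
rewrite big_seq [RHS]big_seq; apply: eq_bigr => m mh.
rewrite /= mevalZ mevalX -[mcoeff m h * _ * _]mulrA [RHS]mulrCA; congr (_ * _).
rewrite mulrA -exprD subnKC ?dmin // /weight.
rewrite expr_sum -big_split; apply: eq_bigr => i _.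
by rewrite mxE exprMn exprM.
Qed.

(** The coefficients outside of the face acquire a positive power of p and vanish
    modulo p. *)
Lemma res_rescaled k d (h : {mpoly A[n]}) : min_weight k h d ->
  map_mpoly res (rescaled k d h) = map_mpoly res (face_poly (\row_i (k i)%:R : 'rV[R]_n) h).
Proof.
move=> hd; rewrite /rescaled /face_poly !rmorph_sum [RHS]big_mkcond.
rewrite big_seq [RHS]big_seq; apply: eq_bigr => m mh.
rewrite /= !map_mpolyZ !map_mpolyX.
case: asboolP => [/(face_exponent R hd mh) wd|nface].
  by rewrite wd subnn mulr1.
have dw : (0 < weight k m - d)%N.
  rewrite subn_gt0 ltn_neqAle (hd.2 m mh) andbT eq_sym; apply/eqP => wd.
  by apply: nface; exact/(face_exponent R hd mh).
by rewrite rmorphM rmorphXn (residueP p_unif) expr0n gtn_eqF // mulr0 scale0r.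
Qed.

Lemma nondegenerate_rescaled k d e (f g : {mpoly A[n]}) z :
  newton_nondegenerate R res f g -> min_weight k f d -> min_weight k g e ->
  (forall j, z j != 0) -> nondegenerate_at (rescaled k d f) (rescaled k e g) z.
Proof.
move=> nd fd ge z0; rewrite /nondegenerate_at.
have k0 : orthant (\row_i (k i)%:R : 'rV[R]_n) by move=> i; rewrite mxE.
have -> : (fun i => map_mpoly res (tnth [tuple rescaled k d f; rescaled k e g] i)) =
    (fun i => map_mpoly res (face_poly (\row_i (k i)%:R : 'rV[R]_n) (tnth [tuple f; g] i))).
  apply/funext => -[[|[|//]] i2]; rewrite !(tnth_nth 0); exact: res_rescaled.
by move=> I I0 hI; exact: (nd _ k0 I I0 z z0 hI).
Qed.

End Initial.

(** * Contribution of the points with given valuations *)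

Lemma exists_small_pow (R : realType) (x r : R) :
  0 <= x -> x < 1 -> 0 < r -> exists M, x ^+ M <= r.
Proof.
move=> x0 x1 r0; have : x ^+ M @[M --> \oo] --> 0 by apply: cvg_expr; rewrite ger0_norm.
move=> /cvgrPdist_le/(_ _ r0)[M _ /(_ M (leqnn _))].
by rewrite sub0r normrN ger0_norm ?exprn_ge0 // => h; exists M.
Qed.

Section CoefficientBound.
Variables (R : realType) (K : localFieldType) (p : integers K).
Hypothesis p_unif : is_uniformizer p.
Local Notation A := (integers K).
Local Notation res := (@residue K).
Local Notation q := ((residue_card K)%:R : R).

Lemma avg_normc n L (Th : 'rV[A]_n -> R[i]) (th : 'rV[A]_n -> R) :
  (forall x, normc (Th x) <= th x) -> normc (avg p L Th) <= avg p L th.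
Proof.
move=> le; rewrite /avg normcM normcV -(rmorph_nat (@real_complex R)) normc_real.
rewrite ger0_norm // ler_pM2l ?invr_gt0 ?card_classes_gt0 //.
by apply: le_trans (normc_sum _ _ _) _; apply: ler_sum.
Qed.

Variables (n c : nat) (chi1 chi2 : K -> R[i]).
Hypotheses (chi1_mod : character_mod p c chi1) (chi2_mod : character_mod p c chi2).
Variable kappa : R[i].
Hypothesis kappaP : cancelling chi2 kappa.
Variables (f g : {mpoly A[n]}) (d e : ('I_n -> nat) -> nat).
Hypotheses (dP : forall k, min_weight k f (d k)) (eP : forall k, min_weight k g (e k)).
Hypothesis nondeg : newton_nondegenerate R res f g.
Variable s : R[i].
Hypothesis s0 : 0 < complex.Re s.
Local Notation rho := (normc (cpow q (- s))).

(** Its average tends to the coefficient W_b of y^b in (1 - kappa y) Z, where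
    chi2 = chi1^-1 in the application. *)
Definition coef_fun b (x : 'rV[A]_n) : R[i] := quasichar p chi1 s (eval_row f x) *
  diff_seq kappa (fun b => char_on p chi2 b (eval_row g x)) b.

Definition coef_trunc M b (x : 'rV[A]_n) : R[i] := truncated p chi1 s M (eval_row f x) *
  diff_seq kappa (fun b => char_on p chi2 b (eval_row g x)) b.

Definition layer (k : 'I_n -> nat) (x : 'rV[A]_n) := [forall i, ord (k i) (x 0 i)].

Lemma kappa_le1 : normc kappa <= 1.
Proof.
case: kappaP => -[-> _]; first by rewrite normc0.
rewrite normcV -(rmorph_nat (@real_complex R)) normc_real ger0_norm //.
by rewrite invf_le1 ?residue_card_gt0 // ltW // residue_card_gt1.
Qed.

Lemma char_diff_norm b (a : A) :
  normc (diff_seq kappa (fun b => char_on p chi2 b a) b) <= 2.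
Proof.
have h b' := char_on_norm p_unif chi2_mod b' a.
apply: le_trans (le_normcB _ _) _; rewrite -[2]/(1 + 1) lerD //.
rewrite normcM mulr_ile1 ?normc_ge0 ?kappa_le1 //.
by case: b => [|b] //; rewrite normc0.
Qed.

Lemma layerP k x : reflect
  (exists2 u : 'rV[A]_n, x = scale_row p k u & forall i, res (u 0 i) != 0) (layer k x).
Proof.
apply: (iffP forallP) => [h|[u -> u0] i]; last first.
  by apply/(ordP p_unif); exists (u 0 i); rewrite ?mxE.
have /fin_all_exists2[u ux u0] : forall i, exists2 u, x 0 i = p ^+ k i * u & res u != 0.
  by move=> i; apply/(ordP p_unif).
exists (\row_i u i) => [|i]; last by rewrite mxE.
by apply/rowP => i; rewrite ux !mxE.
Qed.

Lemma eval_row_layer h k dh x : min_weight k h dh -> layer k x ->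
  dvd_unif dh (eval_row h x).
Proof.
by move=> hd /layerP[u -> _]; rewrite (eval_rescaled p u hd) dvd_unif_pmul.
Qed.

Lemma coef_trunc_close M b x : normc (coef_fun b x - coef_trunc M b x) <= 2 * rho ^+ M.
Proof.
rewrite /coef_fun /coef_trunc -mulrBl normcM mulrC.
by rewrite ler_pM ?normc_ge0 ?char_diff_norm // (truncated_close p_unif chi1_mod).
Qed.

(** The layer is a union of translates of p^(k + c) O^n; this allows to average
    first around each of its points. *)
Lemma layer_shift k (x t : 'rV[A]_n) : layer k (x + scale_row p k (p ^+ c *: t)) = layer k x.
Proof.
have [_ _ _ _ c0] := chi1_mod.
have sh (y v : 'rV[A]_n) : layer k y -> layer k (y + scale_row p k (p ^+ c *: v)).
  move=> /layerP[u -> u0]; apply/layerP; exists (u + p ^+ c *: v).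
    by apply/rowP => i; rewrite !mxE mulrDr.
  by move=> i; rewrite !mxE residueD_pX.
apply/idP/idP => [h|]; last exact: sh.
rewrite -[x](addrK (scale_row p k (p ^+ c *: t))) (_ : - _ = scale_row p k (p ^+ c *: - t)).
  exact: sh.
by apply/rowP => i; rewrite !mxE !mulrN.
Qed.

Lemma coef_trunc_invariant M b L : (M + b + c <= L)%N ->
  invariant_mod p L (coef_trunc M b).
Proof.
move=> ML x t; rewrite /coef_trunc.
have [w ->] := eval_row_cong f x t (p ^+ L); have [v ->] := eval_row_cong g x t (p ^+ L).
rewrite (char_diff_stable_le p_unif chi2_mod); last by lia.
congr (_ * _); rewrite (_ : L = (M + c) + (L - (M + c)))%N; last by lia.
by rewrite exprD -mulrA (truncated_stable p_unif chi1_mod).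
Qed.

Lemma layer_invariant k L : (forall i, k i < L)%N ->
  invariant_mod p L (fun x => (layer k x)%:R : R[i]).
Proof.
move=> kL x t; congr (nat_of_bool _)%:R; apply: eq_forallb => i.
rewrite !mxE /ord !(dvd_unif_addr p_unif) // dvd_unif_pmul //.
by apply: ltnW; exact: kL.
Qed.

Lemma scale_rowD k (u v : 'rV[A]_n) :
  scale_row p k (u + v) = scale_row p k u + scale_row p k v.
Proof. by apply/rowP => i; rewrite !mxE mulrDr. Qed.

(** By translation invariance one may first average on t |-> x + p^(k + c) t for x
    fixed in the layer, and this average is zero by [local_cancel]. *)
Lemma layer_avg_cancel k M b L : (e k + c < b)%N -> (M + b + c <= L)%N ->
  (forall i, k i < L)%N -> avg p L (fun x => (layer k x)%:R * coef_trunc M b x) = 0.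
Proof.
move=> kb ML kL; set Th := fun x => _ * _.
have inv : invariant_mod p L Th.
  by move=> x t; rewrite /Th (layer_invariant kL) (coef_trunc_invariant ML).
rewrite -(avg_cst p n L (avg p L Th)).
under avg_ext => t do rewrite -(avg_shift p_unif (scale_row p k (p ^+ c *: t)) inv).
rewrite avg_exchange -[RHS](avg_cst p n L); apply: avg_ext => x.
rewrite /Th; under avg_ext => t do rewrite layer_shift.
rewrite avgZ; case: (boolP (layer k x)) => [/layerP[u0 -> uu]|_]; last by rewrite mul0r.
rewrite mul1r.
under avg_ext => t do
  rewrite /coef_trunc -scale_rowD (eval_rescaled p _ (dP k)) (eval_rescaled p _ (eP k)).
apply: (local_cancel p_unif chi1_mod chi2_mod) => //; last by lia.
exact: (nondegenerate_rescaled p_unif nondeg (dP k) (eP k)).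
Qed.

Lemma layer_avg_box k L : (forall i, k i <= L)%N ->
  avg p L (fun x => (layer k x)%:R : R) <= q ^- (\sum_i k i).
Proof.
move=> kL; rewrite -(avg_box p_unif R kL); apply: avg_le => x.
rewrite ler_nat; case: (boolP (layer k x)) => // /forallP h.
rewrite lt0b; apply/forallP => i.
by have /andP[] := h i.
Qed.

(** The bound of the contribution of the layer k to W_b: of the c + 1 values of b
    that remain, each gives at most 2 |f|^(Re s) times the measure of the layer. *)
Definition layer_bound b k : R :=
  if (e k <= b <= e k + c)%N then 2 * rho ^+ d k * q ^- (\sum_i k i) else 0.

Lemma layer_avg_le k M b L : (M + b + c <= L)%N -> (forall i, k i < L)%N ->
  normc (avg p L (fun x => (layer k x)%:R * coef_fun b x)) <= layer_bound b k + 2 * rho ^+ M.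
Proof.
move=> ML kL; rewrite /layer_bound.
have r0 : 0 <= 2 * rho ^+ M by rewrite mulr_ge0 // exprn_ge0 // rho_ge0.
have [be|eb] := ltnP b (e k).
  rewrite /= add0r (_ : avg _ _ _ = 0) ?normc0 // -[RHS](avg_cst p n L).
  apply: avg_ext => x; case: (boolP (layer k x)) => [lx|_]; last by rewrite mul0r.
  by rewrite /coef_fun (char_diff_lt p_unif _ _ be) ?mulr0 //; exact: eval_row_layer lx.
have [bec|ecb] := leqP b (e k + c); last first.
  rewrite add0r.
  have -> : avg p L (fun x => (layer k x)%:R * coef_fun b x) =
      avg p L (fun x => (layer k x)%:R * (coef_fun b x - coef_trunc M b x)).
    rewrite -[LHS]subr0 -(layer_avg_cancel ecb ML kL) -avgB.
    by apply: avg_ext => x; rewrite mulrBr.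
  rewrite -[leRHS](avg_cst p n L); apply: avg_normc => x.
  case: (layer k x); first by rewrite mul1r coef_trunc_close.
  by rewrite mul0r normc0.
rewrite -[leLHS]addr0 lerD //.
apply: (@le_trans _ _ (2 * rho ^+ d k * avg p L (fun x => (layer k x)%:R : R))).
  rewrite -avgZ; apply: avg_normc => x.
  case: (boolP (layer k x)) => [lx|_]; last by rewrite mul0r normc0 mulr0.
  rewrite mul1r mulr1 /coef_fun normcM mulrC ler_pM ?normc_ge0 ?char_diff_norm //.
  by apply: (quasichar_norm p_unif chi1_mod) => //; exact: eval_row_layer lx.
rewrite ler_wpM2l ?layer_avg_box //; last by move=> i; exact: ltnW.
by rewrite mulr_ge0 // exprn_ge0 // rho_ge0.
Qed.

Lemma layer_partition N (x : 'rV[A]_n) :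
  \sum_(k : {ffun 'I_n -> 'I_N}) ((layer (fun i => k i) x)%:R : R[i])
  + ([exists i, dvd_unif N (x 0 i)] : nat)%:R = 1.
Proof.
have [/existsP[i0 hi0]|] := boolP [exists i, dvd_unif N (x 0 i)].
  rewrite big1 ?add0r // => k _; apply/eqP; rewrite pnatr_eq0 eqb0.
  apply/negP => /forallP /(_ i0) /andP[_ /negP]; apply.
  by apply: (dvd_unif_le p_unif) hi0.
rewrite negb_exists => /forallP h.
have /fin_all_exists[k0 k0P] : forall i, exists k : 'I_N, ord k (x 0 i).
  by move=> i; have [m om mN] := ord_lt p_unif (h i); exists (Ordinal mN).
rewrite addr0 (bigD1 [ffun i => k0 i]) //= big1 ?addr0 => [|k kk0].
  by rewrite (_ : layer _ _) //; apply/forallP => i; rewrite ffunE.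
apply/eqP; rewrite pnatr_eq0 eqb0; apply: contra kk0 => /forallP hk.
apply/eqP/ffunP => i; rewrite ffunE; apply: val_inj.
exact: ord_inj p_unif _ _ _ (hk i) (k0P i).
Qed.

Lemma coef_fun_norm b x : normc (coef_fun b x) <= 2.
Proof.
rewrite /coef_fun normcM -[leRHS]mul1r ler_pM ?normc_ge0 ?char_diff_norm //.
exact: (quasichar_norm1 p_unif chi1_mod).
Qed.

Lemma avg_coef_le N M b L : (M + b + c + N <= L)%N ->
  normc (avg p L (coef_fun b)) <=
   \sum_(k : {ffun 'I_n -> 'I_N}) (layer_bound b (fun i => k i) + 2 * rho ^+ M)
   + 2 * n%:R * q ^- N.
Proof.
move=> ML.
have -> : avg p L (coef_fun b) =
    \sum_(k : {ffun 'I_n -> 'I_N})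
      avg p L (fun x => (layer (fun i => k i) x)%:R * coef_fun b x)
    + avg p L (fun x => ([exists i, dvd_unif N (x 0 i)] : nat)%:R * coef_fun b x).
  rewrite -avg_sum -avgD; apply: avg_ext => x.
  by rewrite -mulr_suml -mulrDl layer_partition mul1r.
apply: le_trans (le_normcD _ _) _; apply: lerD.
  apply: le_trans (normc_sum _ _ _) _; apply: ler_sum => k _.
  apply: layer_avg_le; first by lia.
  by move=> i; apply: leq_trans (ltn_ord (k i)) _; lia.
apply: (@le_trans _ _ (avg p L (fun x => 2 * \sum_i ((dvd_unif N (x 0 i) : nat)%:R : R)))).
  apply: avg_normc => x.
  have sge0 : 0 <= \sum_i ((dvd_unif N (x 0 i) : nat)%:R : R) by apply: sumr_ge0.
  case: (boolP [exists i, _]) => [/existsP[i hi]|_]; last by rewrite mul0r normc0 mulr_ge0.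
  rewrite mul1r; apply: le_trans (coef_fun_norm _ _) _.
  rewrite -[leLHS]mulr1 ler_pM2l // (bigD1 i) //= hi lerDl.
  by apply: sumr_ge0.
rewrite avgZ avg_sum -mulrA ler_pM2l //.
under eq_bigr => i _ do rewrite (avg_box1 p_unif) ?(leq_trans _ ML) ?leq_addl //.
by rewrite sumr_const card_ord mulr_natl.
Qed.

(** The second term bounds the measure of the points with a coordinate divisible by
    p^N, on which k is not controlled. *)
Lemma limit_coef_le N b (W : R[i]) :
  (forall eps : R, 0 < eps -> exists L0, forall L, (L0 <= L)%N ->
     normc (W - avg p L (coef_fun b)) <= eps) ->
  normc W <= \sum_(k : {ffun 'I_n -> 'I_N}) layer_bound b (fun i => k i)
   + 2 * n%:R * q ^- N.
Proof.
move=> lim; apply/ler_addgt0Pr => eps eps0.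
have eps20 : 0 < eps / 2 by rewrite divr_gt0.
have [L0 hL0] := lim _ eps20.
(* the number of layers, each with an error 2 rho^M; the 1 keeps C positive *)
pose C : R := 2 * #|{ffun 'I_n -> 'I_N}|%:R + 1.
have C0 : 0 < C by rewrite ltr_wpDl // mulr_ge0.
have [M hM] := exists_small_pow (rho_ge0 K s) (rho_lt1 K s0) (divr_gt0 eps20 C0).
pose L := (L0 + (M + b + c + N))%N.
rewrite -(subrK (avg p L (coef_fun b)) W).
apply: le_trans (le_normcD _ _) _.
have h1 := hL0 L (leq_addr _ _).
have h2 := avg_coef_le (leq_addl L0 (M + b + c + N)).
rewrite big_split /= sumr_const in h2.
have h3 : (2 * rho ^+ M) *+ #|{ffun 'I_n -> 'I_N}| <= eps / 2.
  apply: (@le_trans _ _ (C * rho ^+ M)).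
    rewrite -mulr_natr mulrAC ler_wpM2r ?exprn_ge0 ?rho_ge0 //.
    by rewrite /C lerDl.
  by rewrite mulrC -ler_pdivlMr.
move: h1 h2 h3; rewrite /L; lra.
Qed.

End CoefficientBound.

(** * Summation over all valuations, and power series *)

Section GeometricSums.
Variable R : realType.
Implicit Types (x y t : R).

Lemma geometric_le x N : 0 <= x -> x < 1 -> \sum_(a < N) x ^+ a <= (1 - x)^-1.
Proof.
move=> x0 x1; have x10 : 0 < 1 - x by rewrite subr_gt0.
rewrite -(ler_pM2l x10) mulfV ?gt_eqF //.
have := subrX1 x N; have := exprn_ge0 N x0; set S := \sum_(i < N) _ => h1 h2.
rewrite (_ : _ * S = 1 - x ^+ N); first by rewrite lerBlDr lerDl.
by rewrite -[RHS]opprB h2 -mulNr opprB.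
Qed.

Lemma geometric_ffun_le n N x : 0 <= x -> x < 1 ->
  \sum_(k : {ffun 'I_n -> 'I_N}) x ^+ (\sum_i k i) <= (1 - x) ^- n.
Proof.
move=> x0 x1.
under eq_bigr do rewrite expr_sum.
rewrite -(bigA_distr_bigA (fun (_ : 'I_n) (a : 'I_N) => x ^+ a)) /=.
rewrite prodr_const card_ord -exprVn lerXn2r ?nnegrE ?geometric_le //.
  by apply: sumr_ge0 => i _; rewrite exprn_ge0.
by rewrite invr_ge0 subr_ge0 ltW.
Qed.

Lemma sum_window_le e c B : (\sum_(b < B) (e <= b <= e + c) <= c.+1)%N.
Proof.
suff : (\sum_(b < B) (e <= b <= e + c) <= minn (B - e) c.+1)%N.
  by move=> h; apply: leq_trans h (geq_minr _ _).
elim: B => [|B IH]; first by rewrite big_ord0.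
rewrite big_ord_recr /=; move: IH; set S := \sum_(_ < _) _.
by case: (leqP e B) => eB; case: (leqP B (e + c)) => Bec /=; lia.
Qed.

End GeometricSums.

Section CoefficientSum.
Variables (R : realType) (K : localFieldType) (n c : nat).
Local Notation q := ((residue_card K)%:R : R).
Variables (d e : ('I_n -> nat) -> nat) (t0 sigma1 : R) (s : R[i]).
Hypotheses (dP : forall k, (d k + e k)%:R <= t0 * (\sum_i k i)%:R).
Hypotheses (s0 : 0 < complex.Re s) (s1 : complex.Re s <= sigma1) (st : sigma1 * t0 < 1).
Local Notation rho := (normc (cpow q (- s))).
Local Notation Y := (normc (cpow q s)).
Local Notation Y1 := (q `^ sigma1).
Local Notation theta := (q `^ (sigma1 * t0) / q).

Lemma normc_cpow_ge1 : 1 <= Y.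
Proof.
have q0 := residue_card_gt0 R K; rewrite normc_cpow // -[leLHS](powRr0 q).
by apply: ler_powR; [exact: ltW (residue_card_gt1 R K)|exact: ltW].
Qed.

Lemma normc_cpowN_mul : rho * Y = 1.
Proof.
by have q0 := residue_card_gt0 R K; rewrite -normcM cpowN // mulVf ?cpow_neq0 // normc1.
Qed.

Lemma normc_cpow_le : Y <= Y1.
Proof.
have q0 := residue_card_gt0 R K; rewrite normc_cpow // ler_powR //.
exact: ltW (residue_card_gt1 R K).
Qed.

Lemma theta_ge0 : 0 <= theta.
Proof. by rewrite divr_ge0 ?powR_ge0. Qed.

Lemma theta_lt1 : theta < 1.
Proof.
have q0 := residue_card_gt0 R K; rewrite ltr_pdivrMr // mul1r.
rewrite -[ltRHS]powRr1 ?ltW // /powR gt_eqF // ltr_expR ltr_pM2r //.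
by rewrite ln_gt0 // residue_card_gt1.
Qed.

(** With Y = q^(Re s) and rho = 1 / Y, the c + 1 terms are at most
    2 rho^d Y^(e + c) q^(- |k|), and rho^d Y^e <= Y^(d + e) <= q^(sigma1 t0 |k|). *)
Lemma layer_bound_sum_le B k :
  \sum_(b < B) layer_bound K c d e s b k * Y ^+ b
  <= 2 * c.+1%:R * Y1 ^+ c * theta ^+ (\sum_i k i).
Proof.
have q0 := residue_card_gt0 R K; have Y1' := normc_cpow_ge1.
have Y0 : 0 < Y by apply: lt_le_trans Y1'.
pose x := 2 * Y1 ^+ c * theta ^+ (\sum_i k i).
have x0 : 0 <= x by rewrite !mulr_ge0 ?exprn_ge0 ?powR_ge0 ?theta_ge0.
apply: (@le_trans _ _ (\sum_(b < B) (e k <= b <= e k + c)%N%:R * x)); last first.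
  rewrite -mulr_suml -natr_sum (_ : _ * _ ^+ (\sum_i _) = c.+1%:R * x); last first.
    by rewrite /x; ring.
  by rewrite ler_wpM2r // ler_nat sum_window_le.
apply: ler_sum => b _; rewrite /layer_bound.
case: ifP => [/andP[eb bec]|_]; last by rewrite !mul0r.
rewrite mul1r /x -!mulrA ler_pM2l //.
apply: (@le_trans _ _ (rho ^+ d k * (q ^- (\sum_i k i) * Y ^+ (e k + c)))).
  rewrite ler_wpM2l ?exprn_ge0 ?rho_ge0 // ler_wpM2l ?invr_ge0 ?exprn_ge0 ?(ltW q0) //.
  by rewrite ler_weXn2l.
rewrite exprD.
have -> : rho ^+ d k * (q ^- (\sum_i k i) * (Y ^+ e k * Y ^+ c)) =
   Y ^+ c * ((rho ^+ d k * Y ^+ e k) * q ^- (\sum_i k i)) by ring.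
apply: ler_pM; rewrite ?exprn_ge0 ?mulr_ge0 ?invr_ge0 ?exprn_ge0 ?normc_ge0 ?(ltW q0) //.
  by rewrite lerXn2r ?nnegrE ?normc_ge0 ?powR_ge0 ?normc_cpow_le.
rewrite expr_div_n ler_wpM2r ?invr_ge0 ?exprn_ge0 ?(ltW q0) //.
apply: (@le_trans _ _ (Y ^+ (d k + e k))).
  rewrite exprD ler_wpM2r ?exprn_ge0 ?normc_ge0 // lerXn2r ?nnegrE ?normc_ge0 //.
  apply: le_trans normc_cpow_ge1; rewrite -[leRHS]normc_cpowN_mul -[leLHS]mulr1.
  by rewrite ler_wpM2l ?rho_ge0 ?normc_cpow_ge1.
rewrite normc_cpow // -!powR_mulrn ?powR_ge0 // -!powRrM ler_powR //.
  exact: ltW (residue_card_gt1 R K).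
rewrite -mulrA; apply: ler_pM => //; exact: ltW.
Qed.

(** The number of layers considered, N^n, is arbitrary: the last term of the
    hypothesis is made small for B fixed, and the geometric series over k converges
    because sigma1 t0 < 1. *)
Lemma coef_sum_le (W : nat -> R[i]) B :
  (forall N b, normc (W b) <=
     \sum_(k : {ffun 'I_n -> 'I_N}) layer_bound K c d e s b (fun i => k i)
     + 2 * n%:R * q ^- N) ->
  \sum_(b < B) normc (W b) * Y ^+ b <= 2 * c.+1%:R * Y1 ^+ c * (1 - theta) ^- n.
Proof.
move=> hW; have q0 := residue_card_gt0 R K.
apply/ler_addgt0Pr => eps eps0.
pose C := 2 * n%:R * (\sum_(b < B) Y ^+ b) + 1.
have S0 : 0 <= \sum_(b < B) Y ^+ b by apply: sumr_ge0 => b _; rewrite exprn_ge0 ?normc_ge0.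
have C0 : 0 < C by rewrite ltr_wpDl // !mulr_ge0.
have qi0 : 0 <= q^-1 by rewrite invr_ge0 ltW.
have qi1 : q^-1 < 1 by rewrite invf_lt1 // residue_card_gt1.
have [N hN] := exists_small_pow qi0 qi1 (divr_gt0 eps0 C0).
apply: (@le_trans _ _ (\sum_(k : {ffun 'I_n -> 'I_N})
   \sum_(b < B) layer_bound K c d e s b (fun i => k i) * Y ^+ b
   + 2 * n%:R * q ^- N * \sum_(b < B) Y ^+ b)).
  rewrite exchange_big mulr_sumr -big_split; apply: ler_sum => b _ /=.
  by rewrite -mulr_suml -mulrDl ler_wpM2r ?exprn_ge0 ?normc_ge0 ?hW.
apply: lerD.
  apply: (@le_trans _ _ (\sum_(k : {ffun 'I_n -> 'I_N})
    2 * c.+1%:R * Y1 ^+ c * theta ^+ (\sum_i k i))).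
    by apply: ler_sum => k _; exact: layer_bound_sum_le.
  rewrite -mulr_sumr ler_wpM2l ?geometric_ffun_le ?theta_ge0 ?theta_lt1 //.
apply: (@le_trans _ _ (C * q ^- N)).
  rewrite mulrAC ler_wpM2r ?invr_ge0 ?exprn_ge0 ?(ltW q0) //.
  by rewrite /C lerDl.
by rewrite mulrC -ler_pdivlMr // -exprVn.
Qed.

End CoefficientSum.

Section PowerSeries.
Variable R : realType.
Local Notation C := R[i].

(** The constant coefficient is the limit at 0, which vanishes if A > 0; then E / X
    satisfies the hypothesis with A - 1. *)
Lemma poly_low_coef0 A (E : {poly C}) (B : R) :
  (forall y : R, 0 < y -> y < 1 -> normc E.[y%:C%C] <= B * y ^+ A) ->
  forall a, (a < A)%N -> E`_a = 0.
Proof.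
elim: A E => // A IH E hE.
pose E1 := drop_poly 1 E.
have EE : E = E1 * 'X + (E`_0)%:P.
  rewrite -[LHS](poly_take_drop 1) addrC expr1; congr (_ + _).
  apply/polyP => i; rewrite coef_take_poly coefC; by case: i.
have horn y : E.[y] = E1.[y] * y + E`_0.
  by rewrite {1}EE hornerD hornerM hornerX hornerC.
pose S := \sum_(i < size E1) normc E1`_i.
have S0 : 0 <= S by apply: sumr_ge0 => i _; rewrite normc_ge0.
have E1S (y : R) : 0 < y -> y < 1 -> normc E1.[y%:C%C] <= S.
  move=> y0 y1; rewrite horner_coef; apply: le_trans (normc_sum _ _ _) _.
  apply: ler_sum => i _; rewrite normcM normcX normc_real gtr0_norm //.
  by rewrite ler_piMr ?normc_ge0 // exprn_ile1 // ltW.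
have B0 : 0 <= B.
  have h2 : 0 < 2^-1 :> R by rewrite invr_gt0.
  have h21 : 2^-1 < 1 :> R by rewrite invf_lt1 // ltr1n.
  have := le_trans (normc_ge0 _) (hE _ h2 h21).
  by rewrite pmulr_lge0 // exprn_gt0.
have E00 : E`_0 = 0.
  apply: eq0_normc; apply/eqP; rewrite eq_le normc_ge0 andbT.
  apply/ler_addgt0Pr => eps eps0; rewrite add0r.
  pose D := B + S + 1 + eps.
  have D0 : 0 < D by rewrite /D; lra.
  pose y := eps / D.
  have y0 : 0 < y by rewrite divr_gt0.
  have y1 : y < 1 by rewrite /y ltr_pdivrMr // mul1r /D; lra.
  have -> : E`_0 = E.[y%:C%C] - E1.[y%:C%C] * y%:C%C by rewrite horn addrC addKr.
  apply: le_trans (le_normcB _ _) _.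
  rewrite normcM normc_real gtr0_norm //.
  have h1 := hE _ y0 y1; have h2 := E1S _ y0 y1.
  have h3 : y ^+ A.+1 <= y by rewrite exprS ler_piMr ?(ltW y0) // exprn_ile1 // ltW.
  have h4 : y * D = eps by rewrite /y divfK // gt_eqF.
  have h5 : B * y ^+ A.+1 <= B * y by rewrite ler_wpM2l.
  have h6 : normc E1.[y%:C%C] * y <= S * y by rewrite ler_wpM2r // ltW.
  have h7 : y * (1 + eps) >= 0 by rewrite mulr_ge0 ?(ltW y0) // addr_ge0 // ltW.
  have h8 : y * D = B * y + S * y + y * (1 + eps) by rewrite /D; ring.
  lra.
have IH1 : forall a, (a < A)%N -> E1`_a = 0.
  apply: IH => y y0 y1; have := hE y y0 y1.
  rewrite horn E00 addr0 normcM normc_real gtr0_norm // exprSr mulrA.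
  by rewrite ler_pM2r.
by case=> [|a] aA //; rewrite EE E00 addr0 coefMX /= IH1.
Qed.

Definition abs_poly (P : {poly C}) : {poly R} := map_poly (@normc R) P.

Lemma coef_abs_poly P i : (abs_poly P)`_i = normc P`_i.
Proof. by rewrite coef_map_id0 // normc0. Qed.

Lemma abs_polyM_coef (P Q : {poly C}) i : normc (P * Q)`_i <= (abs_poly P * abs_poly Q)`_i.
Proof.
rewrite !coefM; apply: le_trans (normc_sum _ _ _) _; apply: ler_sum => j _.
by rewrite normcM !coef_abs_poly.
Qed.

(** Otherwise the increments of S along m0, m0 + s, m0 + 2 s, ... would add up to
    more than B. *)
Lemma exists_small_increment (S : nat -> R) B s m0 eps :
  (forall i, 0 <= S i <= B) -> 0 < eps ->
  exists2 m, (m0 <= m)%N & S (m + s)%N - S m <= eps.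
Proof.
move=> SB eps0; apply: contrapT => no.
have big J : J%:R * eps <= S (m0 + J * s)%N.
  elim: J => [|J IH]; first by rewrite mul0r; case/andP: (SB (m0 + 0 * s)%N).
  rewrite mulSn [(s + _)%N]addnC addnA.
  have : ~ S (m0 + J * s + s)%N - S (m0 + J * s)%N <= eps.
    by move=> h; apply: no; exists (m0 + J * s)%N => //; exact: leq_addr.
  by move=> /negP; rewrite -ltNge -natr1 mulrDl mul1r; lra.
have B0 : 0 <= B by case/andP: (SB 0%N) => h1 h2; apply: le_trans h1 h2.
have := archi_boundP (divr_ge0 B0 (ltW eps0)); rewrite ltr_pdivrMr // => h.
by have := le_trans (big (Num.bound (B / eps))) (andP (SB _)).2; rewrite leNgt h.
Qed.

(** If P = r * (sum_b W_b y^b) for small y, this is an identity of formal power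
    series, hence it holds at every Y at which the series converges absolutely.
    Modulo X^A the series may be replaced by its partial sum T A. The remaining
    coefficients of P - r * T A come from the last (size r) terms of T A only, so
    their contribution at Y is small for a suitable A. *)
Lemma power_series_continuation (P r : {poly C}) (W : nat -> C) (B0 B : R) (Y : C) :
  (forall A (y : R), 0 < y -> y < 1 ->
     normc (P.[y%:C%C] - r.[y%:C%C] * \sum_(b < A) W b * y%:C%C ^+ b) <= B0 * y ^+ A) ->
  (forall A, \sum_(b < A) normc (W b) * normc Y ^+ b <= B) ->
  normc P.[Y] <= normc r.[Y] * B.
Proof.
move=> hP hW; apply/ler_addgt0Pr => eps eps0.
pose S A := \sum_(b < A) normc (W b) * normc Y ^+ b.
have SB A : 0 <= S A <= B.
  by rewrite hW andbT; apply: sumr_ge0 => b _; rewrite mulr_ge0 ?exprn_ge0 ?normc_ge0.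
pose Cr := (abs_poly r).[normc Y].
have Cr0 : 0 <= Cr.
  rewrite /Cr horner_coef; apply: sumr_ge0 => i _.
  by rewrite coef_abs_poly mulr_ge0 ?exprn_ge0 ?normc_ge0.
have Cr1 : 0 < Cr + 1 by rewrite ltr_wpDl.
have [m mP hm] := @exists_small_increment S B (size r) (size P) _ SB (divr_gt0 eps0 Cr1).
pose A := (m + size r)%N.
pose T k : {poly C} := \poly_(b < k) W b.
have T_horner k y : (T k).[y] = \sum_(b < k) W b * y ^+ b by rewrite horner_poly.
pose E := P - r * T A.
have Elow a : (a < A)%N -> E`_a = 0.
  apply: (@poly_low_coef0 A E B0) => y y0 y1.
  by rewrite /E hornerD hornerN hornerM T_horner hP.
pose U := T A - T m.
have Ehigh a : (A <= a)%N -> E`_a = - (r * U)`_a.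
  move=> Aa; rewrite /E /U mulrBr !coefB.
  rewrite [P`_a]nth_default; last by apply: leq_trans Aa; exact: leq_trans mP (leq_addr _ _).
  rewrite [(r * T m)`_a]nth_default ?sub0r ?subr0 //.
  apply: leq_trans (size_polyMleq _ _) _; apply: leq_trans Aa.
  by apply: leq_trans (leq_pred _) _; rewrite /A addnC leq_add2r size_poly.
have Ebound : normc E.[Y] <= Cr * (S A - S m).
  have -> : S A - S m = (abs_poly U).[normc Y].
    rewrite (@horner_coef_wide _ A) => [|]; last first.
      apply: leq_trans (size_poly _ _) _; apply: leq_trans (size_polyD _ _) _.
      rewrite size_polyN geq_max; apply/andP; split; first exact: size_poly.
      by apply: leq_trans (size_poly _ _) _; exact: leq_addr.
    rewrite /S [X in _ - X](big_ord_widen_cond A xpredT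
      (fun b => normc (W b) * normc Y ^+ b)) ?leq_addr //.
    rewrite [X in _ - X]big_mkcond -sumrB; apply: eq_bigr => i _ /=.
    rewrite coef_abs_poly coefB !coef_poly ltn_ord; case: ifP => _.
      by rewrite !subrr normc0 mul0r.
    by rewrite !subr0.
  rewrite -hornerM.
  pose m' := maxn (size E) (size (abs_poly r * abs_poly U)).
  rewrite (@horner_coef_wide _ m' (abs_poly r * abs_poly U)) ?leq_maxr //.
  rewrite (horner_coef_wide _ (leq_maxl _ _ : (size E <= m')%N)).
  apply: le_trans (normc_sum _ _ _) _; apply: ler_sum => i _.
  rewrite normcM normcX ler_wpM2r ?exprn_ge0 ?normc_ge0 //.
  apply: le_trans (abs_polyM_coef _ _ _).
  case: (ltnP i A) => iA; first by rewrite Elow // normc0 normc_ge0.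
  by rewrite Ehigh // normcN.
have -> : P.[Y] = r.[Y] * (T A).[Y] + E.[Y].
  by rewrite /E hornerD hornerN hornerM addrC subrK.
apply: le_trans (le_normcD _ _) _; apply: lerD.
  rewrite normcM ler_wpM2l ?normc_ge0 // T_horner.
  apply: le_trans (normc_sum _ _ _) _; apply: le_trans (hW A).
  by apply: ler_sum => b _; rewrite normcM normcX.
apply: le_trans Ebound _; apply: (@le_trans _ _ (Cr * (eps / (Cr + 1)))).
  by rewrite ler_wpM2l.
rewrite mulrCA ler_piMr ?(ltW eps0) // ler_pdivrMr // mul1r lerDl ler01 //.
Qed.

End PowerSeries.

(** * Expansion of the zeta integral in powers of q^(-s2) *)

Section ZetaExpansion.
Variables (R : realType) (K : localFieldType) (p : integers K) (n : nat).
Hypothesis p_unif : is_uniformizer p.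
Variable mu : {measure set (borel_space K n) -> \bar R}.
Hypothesis mu_haar : is_normalized_haar mu.
Local Notation A := (integers K).
Local Notation res := (@residue K).
Local Notation q := ((residue_card K)%:R : R).

Definition is_average (Phi : 'rV[A]_n -> R[i]) (W : R[i]) :=
  forall eps : R, 0 < eps -> exists L0, forall L, (L0 <= L)%N ->
     normc (W - avg p L Phi) <= eps.

Definition uniformly_continuousC (Phi : 'rV[A]_n -> R[i]) :=
  forall e : R, 0 < e -> exists L0, forall L, (L0 <= L)%N -> forall x t,
     normc (Phi (x + p ^+ L *: t) - Phi x) <= e.

Lemma embed_inj : injective (@embed K n).
Proof. by move=> a b /rowP h; apply/rowP => i; apply: val_inj; have := h i; rewrite !mxE. Qed.

(** The limit exists because it is an integral over the field. *)
Lemma is_average_exists Phi : uniformly_continuousC Phi -> exists W, is_average Phi W.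
Proof.
move=> uc; pose un (x : borel_space K n) := xget 0 [set a | x = embed a].
have unK a : un (embed a) = a.
  apply/embed_inj/esym; rewrite /un.
  by apply: (@xgetPex _ 0 [set b | embed a = embed b]); exists a.
exists (complex_integral mu (@integral_points K n) (fun x => Phi (un x))) => eps eps0.
have [|L0 hL0] := @riemann_sum R K p n p_unif mu mu_haar (fun x => Phi (un x)) _ _ eps0.
  move=> e e0; have [L0 hL0] := uc _ e0; exists L0 => L LL x t.
  by rewrite !unK; exact: hL0.
exists L0 => L LL; have := hL0 L LL; rewrite (@avg_ext _ _ _ _ _ _ Phi) // => x.
by rewrite unK.
Qed.

Lemma eval_int_embed (h : {mpoly A[n]}) x : eval_int h (embed x) = val (eval_row h x).
Proof.
rewrite /eval_int /eval_row (meval_morph val); apply: meval_eq => i.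
by rewrite mxE.
Qed.

Variables (c : nat) (chi1 chi2 : K -> R[i]).
Hypotheses (chi1_mod : character_mod p c chi1) (chi2_mod : character_mod p c chi2).
Variables (f g : {mpoly A[n]}).
Local Notation rho s := (normc (cpow q (- s))).

Lemma small_tail s (D e : R) : 0 < complex.Re s -> 0 < e -> 0 <= D ->
  exists L0, forall L, (L0 <= L)%N -> (c <= L)%N && (D * rho s ^+ (L - c) <= e).
Proof.
move=> s0 e0 D0; have D1 : 0 < D + 1 by rewrite ltr_wpDl.
have [M hM] := exists_small_pow (rho_ge0 K s) (rho_lt1 K s0) (divr_gt0 e0 D1).
exists (M + c)%N => L ML; apply/andP; split; first by lia.
apply: (@le_trans _ _ (D * (e / (D + 1)))).
  rewrite ler_wpM2l //; apply: le_trans hM.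
  rewrite ler_wiXn2l ?rho_ge0 ?(ltW (rho_lt1 K s0)) //; lia.
rewrite mulrCA ler_piMr ?(ltW e0) // ler_pdivrMr // mul1r lerDl ler01 //.
Qed.

Lemma quasichar_row_uniform chi (h : {mpoly A[n]}) s L x t :
  character_mod p c chi -> 0 < complex.Re s -> (c <= L)%N ->
  normc (quasichar p chi s (eval_row h (x + p ^+ L *: t)) - quasichar p chi s (eval_row h x))
  <= 2 * rho s ^+ (L - c).
Proof.
move=> chi_mod s0 cL; have [w ->] := eval_row_cong h x t (p ^+ L).
exact: (quasichar_uniform p_unif chi_mod).
Qed.

Lemma coef_fun_uniformly_continuous kappa s b : cancelling chi2 kappa -> 0 < complex.Re s ->
  uniformly_continuousC (coef_fun p chi1 chi2 kappa f g s b).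
Proof.
move=> kappaP s0 e e0; have [L0 hL0] := @small_tail s 4 e s0 e0 (ler0n _ _).
exists (L0 + (b + c))%N => L LL x t.
have /andP[cL small] := hL0 L (leq_trans (leq_addr _ _) LL).
rewrite /coef_fun; have [w ew] := eval_row_cong g x t (p ^+ L).
rewrite ew (char_diff_stable_le p_unif chi2_mod); last by lia.
rewrite -mulrBl normcM; apply: le_trans small.
rewrite (_ : 4 * _ = (2 * rho s ^+ (L - c)) * 2); last by ring.
rewrite ler_pM ?normc_ge0 ?(char_diff_norm p_unif chi2_mod kappaP) //.
exact: quasichar_row_uniform.
Qed.

Definition integrand s1 s2 (x : 'rV[A]_n) : R[i] :=
  quasichar p chi1 s1 (eval_row f x) * quasichar p chi2 s2 (eval_row g x).

Lemma zeta_is_average s1 s2 : 0 < complex.Re s1 -> 0 < complex.Re s2 ->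
  is_average (integrand s1 s2) (zeta_integral p mu chi1 chi2 f g s1 s2).
Proof.
move=> s10 s20 eps eps0; 
pose h (x : borel_space K n) := chi1 (angular_component p (eval_int f x)) *
  chi2 (angular_component p (eval_int g x)) *
  cpow (abs_val R (eval_int f x)) s1 * cpow (abs_val R (eval_int g x)) s2.
rewrite (_ : zeta_integral _ _ _ _ _ _ _ _ = complex_integral mu (@integral_points K n) h) //.
have hE x : h (embed x) = integrand s1 s2 x.
  by rewrite /h !eval_int_embed /integrand /quasichar; ring.
have [|L0 hL0] := @riemann_sum R K p n p_unif mu mu_haar h _ _ eps0; last first.
  exists L0 => L LL; have := hL0 L LL.
  by rewrite (@avg_ext _ _ _ _ _ _ (integrand s1 s2)).
move=> e e0; have e20 : 0 < e / 2 by rewrite divr_gt0.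
have [L1 hL1] := @small_tail s1 2 _ s10 e20 (ler0n _ _).
have [L2 hL2] := @small_tail s2 2 _ s20 e20 (ler0n _ _).
exists (maxn L1 L2) => L; rewrite geq_max => /andP[LL1 LL2] x t; rewrite !hE /integrand.
have /andP[cL sm1] := hL1 L LL1; have /andP[_ sm2] := hL2 L LL2.
have u1 := quasichar_row_uniform f x t chi1_mod s10 cL.
have u2 := quasichar_row_uniform g x t chi2_mod s20 cL.
have b1 := quasichar_norm1 p_unif chi1_mod (eval_row f (x + p ^+ L *: t)) s10.
have b2 := quasichar_norm1 p_unif chi2_mod (eval_row g x) s20.
move: u1 u2 b1 b2; set a' := quasichar _ _ _ _; set a := quasichar _ _ _ _.
set b' := quasichar _ _ _ _; set b := quasichar _ _ _ _.
move: a' a b' b => a' a b' b u1 u2 b1 b2.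
have -> : a' * b' - a * b = a' * (b' - b) + (a' - a) * b by ring.
apply: le_trans (le_normcD _ _) _; rewrite !normcM [leRHS]splitr; apply: lerD.
  rewrite -[leRHS]mul1r ler_pM ?normc_ge0 //; exact: le_trans u2 sm2.
rewrite -[leRHS]mulr1 ler_pM ?normc_ge0 //; exact: le_trans u1 sm1.
Qed.

(** Multiplying by 1 - kappa y a partial sum of the expansion of [quasichar] in powers
    of y gives the partial sum of the differences, up to a term in y^B. *)
Lemma char_diff_expand kappa s a B : cancelling chi2 kappa -> 0 < complex.Re s ->
  normc ((1 - kappa * cpow q (- s)) * quasichar p chi2 s a -
    \sum_(b < B) diff_seq kappa (fun b => char_on p chi2 b a) b * cpow q (- s) ^+ b)
  <= 2 * rho s ^+ B.
Proof.
move=> kappaP s0; set y := cpow q (- s).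
have k1 : normc kappa <= 1 by apply: kappa_le1 kappaP.
have y1 : normc y <= 1 by apply: ltW; exact: rho_lt1.
have telescope : \sum_(b < B) diff_seq kappa (fun b => char_on p chi2 b a) b * y ^+ b =
    (1 - kappa * y) * \sum_(b < B) char_on p chi2 b a * y ^+ b
    + kappa * (if B is B'.+1 then char_on p chi2 B' a else 0) * y ^+ B.
  elim: B => [|B IH]; first by rewrite !big_ord0 !mulr0 mul0r addr0.
  rewrite !big_ord_recr /= IH /diff_seq.
  case: B {IH} => [|B]; rewrite ?exprS; ring.
have yB0 : 0 <= normc y ^+ B by rewrite exprn_ge0 ?normc_ge0.
have [aB|aB] := boolP (dvd_unif B a).
  rewrite telescope big1 => [|b _].
    rewrite mulr0 add0r (_ : (if B is _.+1 then _ else _) = 0) ?mulr0 ?mul0r ?subr0.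
      rewrite normcM ler_pM ?normc_ge0 //.
        apply: le_trans (le_normcB _ _) _; rewrite normc1 normcM -[2]/(1 + 1) lerD //.
        by rewrite mulr_ile1 ?normc_ge0.
      exact: (quasichar_norm p_unif chi2_mod).
    case: B aB {telescope yB0} => [|B] aB //.
    by rewrite /char_on; case: ifP => // /andP[_]; rewrite aB.
  rewrite /char_on; case: ifP => [/andP[_ /negP]|_]; last by rewrite mul0r.
  by case; apply: (dvd_unif_le p_unif) aB.
rewrite telescope (quasichar_expand p_unif chi2 s aB) -/y opprD addrA subrr add0r.
rewrite normcN normcM normcX ler_wpM2r //.
rewrite normcM (@le_trans _ _ (1 * 1)) //; last by rewrite mulr1 ler1n.
rewrite ler_pM ?normc_ge0 //.
by case: (B) => [|B']; rewrite ?normc0 // (char_on_norm p_unif chi2_mod).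
Qed.

Lemma zeta_expand kappa s1 s2 (W : nat -> R[i]) B :
  cancelling chi2 kappa -> 0 < complex.Re s1 -> 0 < complex.Re s2 ->
  (forall b, is_average (coef_fun p chi1 chi2 kappa f g s1 b) (W b)) ->
  normc ((1 - kappa * cpow q (- s2)) * zeta_integral p mu chi1 chi2 f g s1 s2 -
    \sum_(b < B) W b * cpow q (- s2) ^+ b) <= 2 * rho s2 ^+ B.
Proof.
move=> kappaP s10 s20 Wav; set y := cpow q (- s2).
apply/ler_addgt0Pr => eps eps0.
have e1 : 0 < eps / (B%:R + 2) by rewrite divr_gt0.
have [L1 hL1] := zeta_is_average s10 s20 e1.
have /fin_all_exists[L2 hL2] : forall b : 'I_B, exists L0, forall L, (L0 <= L)%N ->
    normc (W b - avg p L (coef_fun p chi1 chi2 kappa f g s1 b)) <= eps / (B%:R + 2).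
  by move=> b; exact: Wav.
pose L := (L1 + \sum_b L2 b)%N.
have z1 := hL1 L (leq_addr _ _).
have z2 (b : 'I_B) :
    normc (W b - avg p L (coef_fun p chi1 chi2 kappa f g s1 b)) <= eps / (B%:R + 2).
  by apply: hL2; rewrite /L (bigD1 b) //= addnCA leq_addr.
set Zt := zeta_integral _ _ _ _ _ _ _ _ in z1 *.
pose Av := avg p L (fun x => quasichar p chi1 s1 (eval_row f x) *
  ((1 - kappa * y) * quasichar p chi2 s2 (eval_row g x) -
    \sum_(b < B) diff_seq kappa (fun b => char_on p chi2 b (eval_row g x)) b * y ^+ b)).
have Av_le : normc Av <= 2 * rho s2 ^+ B.
  rewrite -[leRHS](avg_cst p n L); apply: avg_normc => x; rewrite normcM -[leRHS]mul1r.
  rewrite ler_pM ?normc_ge0 ?(quasichar_norm1 p_unif chi1_mod) //.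
  exact: char_diff_expand.
have AvE : Av = (1 - kappa * y) * avg p L (integrand s1 s2) -
    \sum_(b < B) avg p L (coef_fun p chi1 chi2 kappa f g s1 b) * y ^+ b.
  rewrite -avgZ; under [X in _ - X]eq_bigr do rewrite mulrC -avgZ.
  rewrite -avg_sum -avgB; apply: avg_ext => x.
  rewrite mulrBr /integrand mulr_sumr; congr (_ - _); first by ring.
  by apply: eq_bigr => b _; rewrite /coef_fun; ring.
have k1 : normc kappa <= 1 by apply: kappa_le1 kappaP.
have y1 : normc y <= 1 by apply: ltW; exact: rho_lt1.
have -> : (1 - kappa * y) * Zt - \sum_(b < B) W b * y ^+ b = Av +
   ((1 - kappa * y) * (Zt - avg p L (integrand s1 s2)) -
    \sum_(b < B) (W b - avg p L (coef_fun p chi1 chi2 kappa f g s1 b)) * y ^+ b).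
  rewrite AvE; under [X in _ + (_ - X)]eq_bigr do rewrite mulrBl.
  by rewrite sumrB; ring.
apply: le_trans (le_normcD _ _) _; apply: lerD => //.
apply: le_trans (le_normcB _ _) _.
apply: (@le_trans _ _ (2 * (eps / (B%:R + 2)) + B%:R * (eps / (B%:R + 2)))); last first.
  by rewrite -mulrDl [2 + _]addrC mulrCA mulfV ?mulr1 // gt_eqF.
apply: lerD.
  rewrite normcM ler_pM ?normc_ge0 //.
  apply: le_trans (le_normcB _ _) _; rewrite normc1 normcM -[2]/(1 + 1) lerD //.
  by rewrite mulr_ile1 ?normc_ge0.
apply: le_trans (normc_sum _ _ _) _.
rewrite -[B in B%:R * _]card_ord mulr_natl -sumr_const; apply: ler_sum => b _.
rewrite normcM normcX -[leRHS]mulr1 ler_pM ?normc_ge0 ?exprn_ge0 ?normc_ge0 //.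
by rewrite exprn_ile1 ?normc_ge0.
Qed.

End ZetaExpansion.

(** * Restriction to the line s1 + s2 = 0 *)

Section RationalFunctions.
Variables (R : realType) (K : localFieldType).
Local Notation q := ((residue_card K)%:R : R).
Local Notation C := R[i].

Lemma eval_qE (P : {mpoly C[2]}) s1 s2 : eval_q K P s1 s2 =
  \sum_(m <- msupp P) mcoeff m P * (cpow q (- s1) ^+ m ord0 * cpow q (- s2) ^+ m ord_max).
Proof.
rewrite /eval_q mevalE; apply: eq_bigr => m _; congr (_ * _).
by rewrite !big_ord_recl big_ord0 mulr1 !(tnth_nth 0) /=; congr (_ * _ ^+ m _); apply: val_inj.
Qed.

Definition second_variable (P : {mpoly C[2]}) (x : C) : {poly C} :=
  \sum_(m <- msupp P) (mcoeff m P * x ^+ m ord0) *: 'X^(m ord_max).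

Lemma second_variableE P s1 s2 :
  (second_variable P (cpow q (- s1))).[cpow q (- s2)] = eval_q K P s1 s2.
Proof.
rewrite eval_qE /second_variable horner_sum; apply: eq_bigr => m _.
by rewrite hornerZ hornerXn mulrA.
Qed.

(** Here Q (X, 1/X) is written as a Laurent polynomial in X = q^(-s). The power
    X^(- D) is q^(s D). *)
Lemma eval_q_laurent (Q : {mpoly C[2]}) : exists (L : {poly C}) (D : nat),
  forall s, eval_q K Q s (- s) = cpow q s ^+ D * L.[cpow q (- s)].
Proof.
pose D := (\sum_(m <- msupp Q) m ord_max)%N.
exists (\sum_(m <- msupp Q) mcoeff m Q *: 'X^(m ord0 + (D - m ord_max))), D => s.
rewrite eval_qE horner_sum mulr_sumr big_seq [RHS]big_seq; apply: eq_bigr => m mQ.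
have mD : (m ord_max <= D)%N by rewrite /D (big_rem m) //= leq_addr.
have q0 := residue_card_gt0 R K.
rewrite hornerZ hornerXn [RHS]mulrCA; congr (_ * _).
rewrite opprK exprD [RHS]mulrCA; congr (_ * _).
have -> : cpow q s ^+ D = cpow q s ^+ (D - m ord_max) * cpow q s ^+ m ord_max.
  by rewrite -exprD subnK.
by rewrite cpowN // exprVn mulrAC mulfV ?mul1r // expf_neq0 // cpow_neq0.
Qed.

(** A nonzero polynomial has finitely many roots and t |-> q^(-(s + t)) is injective
    on the reals. Hence a pole can be approached through points at which Z is known. *)
Lemma eval_q_neq0_near (Q : {mpoly C[2]}) s eta : (exists s', eval_q K Q s' (- s') != 0) ->
  0 < eta -> exists t : R, [/\ 0 < t, t < eta & eval_q K Q (s + t%:C%C) (- (s + t%:C%C)) != 0].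
Proof.
move=> [s' Qs'] eta0; apply: contrapT => no; have q0 := residue_card_gt0 R K.
have [L [D LE]] := eval_q_laurent Q.
have L0 : L != 0 by apply: contraNneq Qs' => L0; rewrite LE L0 horner0 mulr0.
pose t (j : nat) : R := eta / j.+2%:R.
have t0 j : 0 < t j by rewrite divr_gt0.
have teta j : t j < eta.
  by rewrite /t ltr_pdivrMr // -[ltLHS]mulr1 ltr_pM2l // ltr1n.
pose x j := cpow q (- (s + (t j)%:C%C)).
have xroot j : root L (x j).
  apply: contrapT => nroot; apply: no; exists (t j); split=> //.
  rewrite LE mulf_neq0 ?expf_neq0 ?cpow_neq0 //; exact/negP.
have x_inj : injective x.
  move=> i j /(congr1 (@normc R)); rewrite !normc_cpow // /powR gt_eqF // => /expR_inj.
  have lnq : ln q != 0 by rewrite gt_eqF // ln_gt0 // residue_card_gt1.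
  move=> /(mulIf lnq); rewrite !raddfN !raddfD /= => /addrI/oppr_inj.
  move=> /(mulfI (lt0r_neq0 eta0))/invr_inj/eqP; rewrite eqr_nat => /eqP; lia.
have := @max_poly_roots _ L [seq x j | j <- iota 0 (size L)] L0 _ _.
rewrite size_map size_iota ltnn => h; suff : false by []; apply: h.
  by apply/allP => _ /mapP[j _ ->].
by rewrite map_inj_uniq // iota_uniq.
Qed.

End RationalFunctions.

Section Poles.
Variables (R : realType).
Local Notation C := R[i].

(** The translates s + t with t > 0 real are enough to contradict a pole, and their
    real parts are easily compared with Re s. *)
Lemma pole_unbounded (Z : C -> C) s (M : R) : is_pole Z s ->
  exists2 eta : R, 0 < eta & forall t : R, 0 < t -> t < eta -> M < normc (Z (s + t%:C%C)).
Proof.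
move=> pole; have := pole [set x : C | M%:C%C < x].
case; first by exists M%:C%C; split=> //; rewrite complex_real.
move=> e /= e0 he; have [eta eE] : exists eta : R, e = eta%:C%C.
  by apply/complex_realP; rewrite realE ltW.
have eta0 : 0 < eta by rewrite -ltcR -eE.
exists eta => // t t0 t_eta; rewrite -ltcR -norm_normc; apply: he => /=.
  rewrite opprD addrA subrr sub0r normrN norm_normc normc_real gtr0_norm // eE ltcR //.
rewrite -subr_eq0 addrAC subrr add0r; apply: contraTneq t0 => /complexI ->.
by rewrite ltxx.
Qed.

End Poles.

Section Restriction.
Variables (R : realType) (K : localFieldType) (p : integers K) (n : nat).
Hypothesis p_unif : is_uniformizer p.
Variable mu : {measure set (borel_space K n) -> \bar R}.
Hypothesis mu_haar : is_normalized_haar mu.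
Local Notation A := (integers K).
Local Notation q := ((residue_card K)%:R : R).
Variables (c : nat) (chi1 chi2 : K -> R[i]).
Hypotheses (chi1_mod : character_mod p c chi1) (chi2_mod : character_mod p c chi2).
Variable kappa : R[i].
Hypothesis kappaP : cancelling chi2 kappa.
Variables (f g : {mpoly A[n]}) (d e : ('I_n -> nat) -> nat).
Hypotheses (dP : forall k, min_weight k f (d k)) (eP : forall k, min_weight k g (e k)).
Hypothesis nondeg : newton_nondegenerate R (@residue K) f g.
Variables (t0 sigma1 : R).
Hypotheses (deP : forall k, (d k + e k)%:R <= t0 * (\sum_i k i)%:R).
Hypothesis st : sigma1 * t0 < 1.
Variables P Q : {mpoly R[i][2]}.
Hypothesis PQ : forall s1 s2, 0 < complex.Re s1 -> 0 < complex.Re s2 ->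
  eval_q K Q s1 s2 != 0 ->
  zeta_integral p mu chi1 chi2 f g s1 s2 = eval_q K P s1 s2 / eval_q K Q s1 s2.

Lemma real_cpow_onto (y : R) : 0 < y -> y < 1 ->
  exists2 s : R[i], 0 < complex.Re s & cpow q (- s) = y%:C%C.
Proof.
move=> y0 y1; have q0 := residue_card_gt0 R K; have q1 := residue_card_gt1 R K.
have lnq : 0 < ln q by rewrite ln_gt0.
exists (- (ln y / ln q))%:C%C => /=.
  by rewrite -mulNr divr_gt0 // oppr_gt0 ln_lt0 // y0.
rewrite rmorphN opprK cpow_real // /powR gt_eqF // divfK ?gt_eqF //.
by rewrite lnK // posrE.
Qed.

Lemma horner_unit_le (r : {poly R[i]}) (y : R) : 0 < y -> y < 1 ->
  normc r.[y%:C%C] <= \sum_(i < size r) normc r`_i.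
Proof.
move=> y0 y1; rewrite horner_coef; apply: le_trans (normc_sum _ _ _) _.
apply: ler_sum => i _; rewrite normcM normcX normc_real gtr0_norm //.
by rewrite ler_piMr ?normc_ge0 // exprn_ile1 // ltW.
Qed.

(** The expression of Z as P / Q says nothing where Q vanishes. Multiplying
    P = Q Z by Q gives P Q = Q^2 Z, which holds everywhere, and the power series
    identity can be applied to it for s1 = s fixed. At s2 = - s it is divided by
    Q^2 again. *)
Lemma restriction_bound s : 0 < complex.Re s -> complex.Re s <= sigma1 ->
  eval_q K Q s (- s) != 0 ->
  normc (eval_q K P s (- s) / eval_q K Q s (- s)) * normc (1 - kappa * cpow q s)
  <= 2 * c.+1%:R * (q `^ sigma1) ^+ c * (1 - q `^ (sigma1 * t0) / q) ^- n.
Proof.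
move=> s0 s1 Q0; set B := (X in _ <= X).
have /choice[W Wav] : forall b, exists W, is_average p (coef_fun p chi1 chi2 kappa f g s b) W.
  move=> b; apply: (is_average_exists p_unif mu_haar).
  exact: (coef_fun_uniformly_continuous p_unif chi1_mod chi2_mod).
pose x := cpow q (- s).
pose PP := second_variable P x * second_variable Q x * (1 - kappa *: 'X).
pose r := second_variable Q x ^+ 2.
have PPE s2 : PP.[cpow q (- s2)] =
    eval_q K P s s2 * eval_q K Q s s2 * (1 - kappa * cpow q (- s2)).
  by rewrite /PP !hornerM !second_variableE hornerD hornerN hornerZ hornerX hornerC.
have rE s2 : r.[cpow q (- s2)] = eval_q K Q s s2 ^+ 2.
  by rewrite /r horner_exp second_variableE.
have bound := @power_series_continuation R PP r W
  (2 * \sum_(i < size r) normc r`_i) B (cpow q (- (- s))).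
move: bound; rewrite PPE rE opprK => bound.
have {}bound : normc (eval_q K P s (- s) * eval_q K Q s (- s) * (1 - kappa * cpow q s)) <=
    normc (eval_q K Q s (- s) ^+ 2) * B.
  apply: bound => [N y y0 y1|N]; last first.
    apply: (coef_sum_le deP s0 s1 st) => N' b.
    exact: (limit_coef_le p_unif chi1_mod chi2_mod kappaP dP eP nondeg s0 N' (Wav b)).
  have [s2 s20 s2y] := real_cpow_onto y0 y1.
  have yE : normc (cpow q (- s2)) = y by rewrite s2y normc_real gtr0_norm.
  have := horner_unit_le r y0 y1; rewrite -s2y rE => ry.
  rewrite PPE; have [Q20|Q20] := eqVneq (eval_q K Q s s2) 0.
    rewrite Q20 mulr0 mul0r expr0n /= mul0r subrr normc0.
    by rewrite !mulr_ge0 ?exprn_ge0 ?(ltW y0) // sumr_ge0 // => i _; exact: normc_ge0.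
  have := zeta_expand p_unif mu_haar chi1_mod chi2_mod N kappaP s0 s20 Wav.
  rewrite PQ // yE; set S := \sum_(b < N) _ => ze.
  rewrite [X in normc X](_ : _ = eval_q K Q s s2 ^+ 2 *
    ((1 - kappa * cpow q (- s2)) * (eval_q K P s s2 / eval_q K Q s s2) - S)); last by field.
  rewrite normcM (_ : 2 * _ * _ = (\sum_(i < size r) normc r`_i) * (2 * y ^+ N)); last by ring.
  by rewrite ler_pM ?normc_ge0.
have nQ : 0 < normc (eval_q K Q s (- s)).
  rewrite lt_neqAle normc_ge0 andbT eq_sym; apply: contra Q0 => /eqP/eq0_normc ->; exact: eqxx.
rewrite normcM normcV mulrAC ler_pdivrMr // -(ler_pM2r nQ) -!normcM.
rewrite (_ : _ * _ * eval_q K Q s (- s) =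
  eval_q K P s (- s) * eval_q K Q s (- s) * (1 - kappa * cpow q s)); last by ring.
by rewrite -[leRHS]mulrA -expr2 -normcX [leRHS]mulrC.
Qed.

End Restriction.

(** * Absence of poles *)

Section NoPole.
Variables (R : realType) (K : localFieldType).
Local Notation A := (integers K).
Local Notation q := ((residue_card K)%:R : R).

(** For the trivial character, |q^(z - 1)| stays on the same side of 1 as at s, for z
    slightly to the right of s. *)
Lemma euler_factor_away (kappa s : R[i]) (sigma1 : R) :
  complex.Re s < sigma1 -> (complex.Re s < 1 -> sigma1 < 1) ->
  kappa = 0 \/ (kappa = (residue_card K)%:R^-1 /\ complex.Re s <> 1) ->
  exists2 delta : R, 0 < delta & forall t : R, 0 < t -> complex.Re s + t <= sigma1 ->
    delta <= normc (1 - kappa * cpow q (s + t%:C%C)).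
Proof.
move=> ss1 s1 [->|[-> sn1]].
  by exists 1 => // t _ _; rewrite mul0r subr0 normc1.
have q0 := residue_card_gt0 R K; have q1 := residue_card_gt1 R K.
pose w t := (residue_card K)%:R^-1 * cpow q (s + t%:C%C).
have wE t : normc (w t) = q `^ (complex.Re s + t - 1).
  rewrite /w normcM normcV -(rmorph_nat (@real_complex R)) normc_real ger0_norm ?(ltW q0) //.
  rewrite normc_cpow // raddfD /= powRB; last by rewrite (gt_eqF q0) implybT.
  by rewrite powRr1 ?(ltW q0) // mulrC.
have [sl1|sg1|//] := ltgtP (complex.Re s) 1.
  exists (1 - q `^ (sigma1 - 1)).
    rewrite subr_gt0 /powR gt_eqF // expR_lt1 pmulr_llt0 ?ln_gt0 //.
    by rewrite subr_lt0 s1.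
  move=> t t0 ts; rewrite lerBlDr.
  have : normc (w t) <= q `^ (sigma1 - 1).
    by rewrite wE ler_powR ?(ltW q1) // lerD2r.
  have := le_normcD (1 - w t) (w t); rewrite subrK normc1; rewrite -/(w t); lra.
exists (q `^ (complex.Re s - 1) - 1).
  rewrite subr_gt0 /powR gt_eqF // expR_gt1 mulr_gt0 ?ln_gt0 // subr_gt0 //.
move=> t t0 ts.
have : q `^ (complex.Re s - 1) <= normc (w t).
  by rewrite wE ler_powR ?(ltW q1) // lerD2r lerDl ltW.
have := le_normcB 1 (1 - w t); rewrite opprB addrCA subrr addr0 normc1; rewrite -/(w t); lra.
Qed.

Variables (p : integers K) (n : nat).
Hypothesis p_unif : is_uniformizer p.
Variable mu : {measure set (borel_space K n) -> \bar R}.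
Hypothesis mu_haar : is_normalized_haar mu.
Variables (c : nat) (chi : K -> R[i]) (kappa : R[i]).
Hypothesis chi_mod : character_mod p c chi.
Hypothesis kappaP : cancelling (fun u => (chi u)^-1) kappa.
Variables (f g : {mpoly A[n]}) (t0 : R) (Z : R[i] -> R[i]).
Hypotheses (f0 : f != 0) (g0 : g != 0).
Hypothesis nondeg : newton_nondegenerate R (@residue K) f g.
Hypothesis t0_closure : closure (newton_polyhedron R (f * g)) (const_mx t0).
Hypothesis zetaZ : is_zeta p mu chi f g Z.

(** A bound sigma1 is chosen between Re s and 1 / t0, and below 1 if Re s < 1; on
    the segment from s to s + (sigma1 - Re s), Z is bounded wherever it is known. *)
Lemma no_pole (s : R[i]) : 0 < complex.Re s -> complex.Re s < 1 / t0 ->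
  kappa = 0 \/ (kappa = (residue_card K)%:R^-1 /\ complex.Re s <> 1) ->
  ~ is_pole Z s.
Proof.
move=> s0 st kap pole.
have t00 : 0 < t0.
  by have := lt_trans s0 st; rewrite mul1r invr_gt0.
pose m := if complex.Re s < 1 then Num.min (1 / t0) 1 else 1 / t0.
have sm : complex.Re s < m.
  by rewrite /m; case: ifP => // s1; rewrite lt_min st s1.
have mt : m <= 1 / t0 by rewrite /m; case: ifP => // _; rewrite ge_min lexx.
have m1 : complex.Re s < 1 -> m <= 1.
  by rewrite /m => ->; rewrite ge_min lexx orbT.
pose sigma1 := (complex.Re s + m) / 2.
have ss1 : complex.Re s < sigma1 by rewrite /sigma1; lra.
have s1m : sigma1 < m by rewrite /sigma1; lra.
have s11 : complex.Re s < 1 -> sigma1 < 1 by move=> /m1; lra.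
have s1t : sigma1 * t0 < 1 by rewrite -ltr_pdivlMr //; lra.
have [delta delta0 hdelta] := euler_factor_away ss1 s11 kap.
have [P [Q [PQ Qn0 ZE]]] := zetaZ.
have /choice[d dP] : forall k, exists d, min_weight k f d.
  by move=> k; exact: min_weight_exists.
have /choice[e eP] : forall k, exists e, min_weight k g e.
  by move=> k; exact: min_weight_exists.
have deP k : (d k + e k)%:R <= t0 * (\sum_i k i)%:R := diagonal_bound t0_closure (dP k) (eP k).
have bound := restriction_bound p_unif mu_haar chi_mod (character_mod_inv chi_mod)
  kappaP dP eP nondeg deP s1t PQ.
set B := 2 * _ * _ * _ in bound.
have [eta eta0 big] := @pole_unbounded R Z s (B / delta) pole.
have eta10 : 0 < Num.min eta (sigma1 - complex.Re s) by rewrite lt_min eta0 subr_gt0.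
have [t [tpos]] := eval_q_neq0_near s Qn0 eta10.
rewrite lt_min => /andP[t_eta t_s1] Qt.
have sz : complex.Re s + t <= sigma1 by lra.
have Rez : complex.Re (s + t%:C%C) = complex.Re s + t by rewrite raddfD.
have := bound (s + t%:C%C); rewrite Rez => /(_ (addr_gt0 s0 tpos) sz Qt).
rewrite -ZE // => h1; have h2 := hdelta t tpos sz; have h3 := big t tpos t_eta.
move: h3; rewrite ltr_pdivrMr // ltNge => /negP; apply.
by apply: le_trans h1; rewrite ler_wpM2l ?normc_ge0.
Qed.

End NoPole.

Theorem proposition4p7 (R : realType) (K : localFieldType) (p : integers K)
    (n : nat) (mu : {measure set (borel_space K n) -> \bar R})
    (f g : {mpoly (integers K)[n]}) (chi : K -> R[i]) (t0 : R)
    (Z : R[i] -> R[i]) :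
  is_uniformizer p ->
  (2 <= n)%N ->
  is_normalized_haar mu ->
  ~ (exists h : {mpoly (integers K)[n]}, f = p *: h) ->
  ~ (exists h : {mpoly (integers K)[n]}, g = p *: h) ->
  nonconstant f -> nonconstant g ->
  coprime_mpoly f g ->
  meval (fun=> 0) f = 0 -> meval (fun=> 0) g = 0 ->
  newton_polyhedron R f <> newton_polyhedron R g ->
  newton_nondegenerate R (@residue K) f g ->
  is_character chi ->
  diagonal_line R n `&` boundary (newton_polyhedron R (f * g)) = [set const_mx t0] ->
  is_zeta p mu chi f g Z ->
  forall s : R[i], is_pole Z s -> 0 < complex.Re s ->
    (~ is_trivial_character chi -> 1 / t0 <= complex.Re s) /\
    (is_trivial_character chi -> complex.Re s = 1 \/ 1 / t0 <= complex.Re s).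
Proof.
move=> p_unif _ mu_haar _ _ f_nc g_nc _ _ _ _ nondeg chi_char diag zetaZ s pole s0.
have f0 : f != 0 by apply/eqP => f0; apply: f_nc; exists 0; rewrite mpolyC0.
have g0 : g != 0 by apply/eqP => g0; apply: g_nc; exists 0; rewrite mpolyC0.
have [_ [t0_closure _]] : (diagonal_line R n `&` boundary (newton_polyhedron R (f * g)))
  (const_mx t0) by rewrite diag.
split=> [nontriv|triv].
  rewrite leNgt; apply/negP => st.
  have [c chi_mod] := character_mod_exists p_unif chi_char.
  have kappaP : @cancelling R K (fun u => (chi u)^-1) 0.
    left; split=> //; apply: contrapT => no; apply: nontriv => z /integer_unitP[u -> u0].
    apply: contrapT => /eqP chi1; apply: no; exists u => //.
    by rewrite invr_eq1.
  apply: (no_pole p_unif mu_haar chi_mod kappaP f0 g0 nondeg t0_closure zetaZ s0 st _ pole).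
  by left.
(* the factor 1 - q^(s - 1) is invertible as Re s differs from 1 *)
have [s1|s1] := eqVneq (complex.Re s) 1; [by left|right].
rewrite leNgt; apply/negP => st.
have chi_mod := character_mod_trivial p_unif chi_char triv.
have kappaP : @cancelling R K (fun u => (chi u)^-1) (residue_card K)%:R^-1.
  by right; split=> // u u0; rewrite triv ?invr1 // integer_unitE.
apply: (no_pole p_unif mu_haar chi_mod kappaP f0 g0 nondeg t0_closure zetaZ s0 st _ pole).
by right; split=> //; exact/eqP.
Qed.
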